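(* Let $\varphi$ be an Orlicz N-function satisfying Assumption Q. Let $\mathbf X(t)$, $t\in\mathbb R$, be a strictly $Sub_\varphi(\Omega)$ stationary short-memory random process with covariance function $R(t-s):=\mathbf E\mathbf X(t)\overline{\mathbf X(s)}$, such that $\mathbf E\mathbf X(t)=0$, $\mathbf E|\mathbf X(t)|^2<\infty$ for all $t$, and the covariance function is continuous. Let $\phi$ be an $f$-wavelet and $\psi$ the corresponding $m$-wavelet, both continuous and both satisfying Assumption S with the function $\Phi$. Let $c:\mathbb R\to\mathbb R$ be an even function, non-decreasing on $[0,\infty)$, with $c(0)>1$, for which there exist $A:(0,\infty)\to(0,\infty)$ and $x_0\in\mathbb R$ such that $c(ax)\le c(x)A(a)$ for all $x\ge x_0$ and all $a>0$. Assume $\int_{\mathbb R}c(x)\Phi(|x|)\,dx<\infty$ and $|R(0)|^{1/2}\le c(t)$ for all $t\in\mathbb R$. Let $T>0$, $p\ge1$ and $\int_0^T(\mathbf E(\mathbf X(t))^2)^{p/2}\,dt<+\infty$. Suppose that the Fourier transform $\widehat R(z)=\int_{\mathbb R}e^{-izt}R(t)\,dt$ exists and that for some $\alpha>0$ $$\int_{\mathbb R}|\widehat R(z)|\cdot|z|^\alpha\,dz<\infty .$$ If $\widehat\psi$ is a Lipschitz function of order $\alpha/2$ (i.e. $|\widehat\psi(x)-\widehat\psi(y)|\le L|x-y|^{\alpha/2}$ for some constant $L$ and all $x,y\in\mathbb R$), then $$\sup_{k\in\mathbb Z}(\mathbf E|\xi_{0k}|^2)^{1/2}C_\phi+\sum_{j=0}^\infty\sup_{k\in\mathbb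 Z}(\mathbf E|\eta_{jk}|^2)^{1/2}\,2^{j/2}C_\psi<\infty .$$
   Context: Sub-Gaussian notions. An Orlicz N-function is a continuous even convex function $\varphi:\mathbb R\to\mathbb R$, monotonically increasing for $x>0$, with $\varphi(0)=0$, $\varphi(x)/x\to0$ as $x\to0$ and $\varphi(x)/x\to\infty$ as $x\to\infty$. Assumption Q: $\lim_{x\to0}\varphi(x)/x^2=c_0>0$ (the value $c_0=+\infty$ is allowed). On a probability space $(\Omega,\mathcal B,\mathbf P)$, a zero-mean random variable $\xi$ is in $Sub_\varphi(\Omega)$ if there is $r\ge0$ with $\mathbf E\exp(\lambda\xi)\le\exp(\varphi(r\lambda))$ for all $\lambda\in\mathbb R$; $\tau_\varphi(\xi):=\inf\{a\ge0:\mathbf E\exp(\lambda\xi)\le\exp(\varphi(a\lambda))\ \forall\lambda\in\mathbb R\}$ is a Banach norm on this space. A process $\mathbf X(t)$, $t\in\mathbf T$, is in $Sub_\varphi(\Omega)$ if $\mathbf X(t)\in Sub_\varphi(\Omega)$ for all $t\in\mathbf T$ and $\sup_{t\in\mathbf T}\tau_\varphi(\mathbf X(t))<\infty$. It is strictly $Sub_\varphi(\Omega)$ if there is a constant $C_X>0$ such that for every finite set $I$, $t_i\in\mathbf T$, $\lambda_i\in\mathbb R$, $i\in I$: $\tau_\varphi(\sum_{i\in I}\lambda_i\mathbf X(t_i))\le C_X(\mathbf E(\sum_{i\in I}\lambda_i\mathbf X(t_i))^2)^{1/2}$. A stationary process is short-memory if its covariance function is absolutely integrable, $\int_{\mathbb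 R}|R(t)|\,dt<\infty$. Wavelets. Fourier transform: $\widehat\phi(y)=\int_{\mathbb R}e^{-iyx}\phi(x)\,dx$. A function $\phi\in L_2(\mathbb R)$ is an $f$-wavelet if $\widehat\phi(0)\ne0$, $\widehat\phi$ is continuous at $0$, $\sum_{k\in\mathbb Z}|\widehat\phi(y+2\pi k)|^2=1$ a.e., and there is a $2\pi$-periodic $m_0\in L_2([0,2\pi])$ with $\widehat\phi(y)=m_0(y/2)\widehat\phi(y/2)$ a.e. The corresponding $m$-wavelet $\psi$ is the inverse Fourier transform of $\widehat\psi(y)=\overline{m_0(y/2+\pi)}\,e^{-iy/2}\,\widehat\phi(y/2)$. Set $\phi_{jk}(x)=2^{j/2}\phi(2^jx-k)$, $\psi_{jk}(x)=2^{j/2}\psi(2^jx-k)$. Assumption S for a function $\delta$, with function $\Phi$: $\Phi:[0,\infty)\to[0,\infty)$ is decreasing, $\Phi(0)<\infty$, $|\delta(x)|\le\Phi(|x|)$ a.e., and $\int_{\mathbb R}\Phi(|x|)\,dx<\infty$. For $\delta\in\{\phi,\psi\}$ put $C_\delta:=3\Phi(0)+4\int_{1/2}^\infty\Phi(t)\,dt$. Wavelet coefficients. $\xi_{0k}:=\int_{\mathbb R}\mathbf X(t)\overline{\phi_{0k}(t)}\,dt$, $\eta_{jk}:=\int_{\mathbb R}\mathbf X(t)\overline{\psi_{jk}(t)}\,dt$ (mean-square integrals), $j\in\mathbb N_0=\{0,1,2,\dots\}$, $k\in\mathbb Z$. *)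

(* Defs.v *)
From HB Require Import structures.
From mathcomp Require Import all_boot all_order all_algebra.
From mathcomp Require Export complex.
From mathcomp Require Import all_classical all_reals all_analysis.

Set Implicit Arguments.
Unset Strict Implicit.
Unset Printing Implicit Defensive.

Import Order.TTheory GRing.Theory Num.Theory numFieldNormedType.Exports.

Local Open Scope classical_set_scope.
Local Open Scope complex_scope.
Local Open Scope ring_scope.

(* The complex numbers over R are R[i]; it carries neither a topology nor a
   measurable structure over R, so continuity, measurability and integrals of
   complex-valued functions are taken componentwise.  [Normc.normc] is the
   R-valued modulus. *)
Notation cmod := Normc.normc.

Section ComplexValued.
Context {R : realType}.
Local Notation leb := (@lebesgue_measure R).

Definition ccontinuous (f : R -> R[i]) : Prop :=
  continuous (fun x => complex.Re (f x)) /\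
  continuous (fun x => complex.Im (f x)).

Definition ccontinuous_at (f : R -> R[i]) (x : R) : Prop :=
  {for x, continuous (fun y => complex.Re (f y))} /\
  {for x, continuous (fun y => complex.Im (f y))}.

Definition cmeasurable {d} {S : measurableType d} (D : set S)
    (f : S -> R[i]) : Prop :=
  measurable_fun D (fun x => complex.Re (f x)) /\
  measurable_fun D (fun x => complex.Im (f x)).

Definition cintegrable (f : R -> R[i]) : Prop :=
  leb.-integrable setT (fun x => (complex.Re (f x))%:E) /\
  leb.-integrable setT (fun x => (complex.Im (f x))%:E).

Definition cintegral (f : R -> R[i]) : R[i] :=
  Rintegral leb setT (fun x => complex.Re (f x)) +i*
  Rintegral leb setT (fun x => complex.Im (f x)).

Definition square_integrable (D : set R) (f : R -> R[i]) : Prop :=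
  cmeasurable (D : set (measurableTypeR R)) f /\
  (\int[leb]_(x in D) (cmod (f x) ^+ 2)%:E < +oo)%E.

(* cis x = e^{ix} *)
Definition cis (x : R) : R[i] := cos x +i* sin x.

Definition fourier (f : R -> R[i]) (y : R) : R[i] :=
  cintegral (fun x => cis (- (y * x)) * f x).

(* The integral defining [fourier f] converges absolutely; otherwise [fourier f]
   takes default values.  Below, [fourier] is applied to functions that are
   integrable by short memory or by [assumption_S], so it coincides (a.e.) with
   the Fourier-Plancherel transform. *)
Definition fourier_exists (f : R -> R[i]) : Prop := cintegrable f.

Definition lipschitz_of_order (a : R) (f : R -> R[i]) : Prop :=
  exists L : R, forall x y, cmod (f x - f y) <= L * `|x - y| `^ a.

End ComplexValued.

Section OrliczFunctions.
Context {R : realType}.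

Definition orlicz_N_function (vphi : R -> R) : Prop :=
  [/\ continuous vphi,
      (forall x, vphi (- x) = vphi x),
      convex_function [set: convex_lmodType R^o] vphi &
      {in `]0, +oo[%R &, {homo vphi : x y / x <= y}}] /\
  [/\ vphi 0 = 0,
      vphi x / x @[x --> 0^'] --> 0 &
      vphi x / x @[x --> +oo] --> +oo].

Definition assumption_Q (vphi : R -> R) : Prop :=
  exists2 c0 : \bar R, (0 < c0)%E &
    (vphi x / x ^+ 2)%:E @[x --> (0 : R)^'] --> c0.

End OrliczFunctions.

Section SubGaussian.
Context {R : realType} {d : measure_display} {Omega : measurableType d}.
Variable P : probability Omega R.

Definition exp_moment_bound (vphi : R -> R) (xi : Omega -> R) (a : R) : Prop :=
  forall l : R,
    ('E_P[fun w => expR (l * xi w)%R] <= (expR (vphi (a * l)%R))%:E)%E.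

Definition in_Sub (vphi : R -> R) (xi : {RV P >-> R}) : Prop :=
  ('E_P[xi] = 0)%E /\ exists2 r : R, 0 <= r & exp_moment_bound vphi xi r.

(* The infimum is taken in \bar R, so it is +oo when there is no admissible a. *)
Definition tau (vphi : R -> R) (xi : Omega -> R) : \bar R :=
  ereal_inf [set a%:E | a in [set a : R | 0 <= a /\ exp_moment_bound vphi xi a]].

Definition process_in_Sub (vphi : R -> R) (X : R -> {RV P >-> R}) : Prop :=
  (forall t, in_Sub vphi (X t)) /\
  (ereal_sup (range (fun t => tau vphi (X t))) < +oo)%E.

Definition linear_comb (X : R -> {RV P >-> R}) (I : finType) (l t : I -> R)
    (w : Omega) : R := \sum_(i : I) l i * X (t i) w.

Definition strictly_Sub (vphi : R -> R) (X : R -> {RV P >-> R}) : Prop :=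
  process_in_Sub vphi X /\
  exists2 C : R, 0 < C & forall (I : finType) (l t : I -> R),
    (tau vphi (linear_comb X l t) <=
       C%:E * ('E_P[fun w => (linear_comb X l t w ^+ 2)%R] `^ 2^-1))%E.

(* Wide-sense stationarity of a centred real process. *)
Definition stationary_with_covariance (X : R -> {RV P >-> R}) (rho : R -> R)
    : Prop :=
  forall t s, ('E_P[fun w => (X t w * X s w)%R] = (rho (t - s)%R)%:E)%E.

End SubGaussian.

Definition short_memory {R : realType} (rho : R -> R) : Prop :=
  (\int[lebesgue_measure]_t `|rho t|%:E < +oo)%E.

Section MeanSquareIntegral.
Context {R : realType} {d : measure_display} {Omega : measurableType d}.
Variable P : probability Omega R.
Implicit Types (Y : R -> Omega -> R[i]) (Z : Omega -> R[i]).

Definition mean_square Z : \bar R := ('E_P[fun w => (cmod (Z w) ^+ 2)%R])%E.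
Definition rms Z : \bar R := (mean_square Z `^ 2^-1)%E.

(* The partition a = x_0 < x_1 < ... < x_n = b is given by s = [:: x_1; ...; x_n],
   so that x_i is [nth b (a :: s) i]; u i is the tag in [x_i, x_{i+1}]. *)
Definition tagged_partition (a b : R) (s : seq R) (u : nat -> R) : Prop :=
  itv_partition a b s /\
  forall i, (i < size s)%N -> nth b (a :: s) i <= u i <= nth b s i.

Definition riemann_sum Y (a b : R) (s : seq R) (u : nat -> R) (w : Omega)
    : R[i] :=
  \sum_(i < size s) (nth b s i - nth b (a :: s) i)%:C * Y (u i) w.

(* Z is (a version of) the mean-square Riemann integral of Y over [a, b]. *)
Definition is_ms_integral Y (a b : R) Z : Prop :=
  cmeasurable setT Z /\
  forall e : R, 0 < e -> exists2 delta : R, 0 < delta &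
    forall s u, tagged_partition a b s u ->
      (forall i, (i < size s)%N -> nth b s i - nth b (a :: s) i < delta) ->
      (mean_square (fun w => riemann_sum Y a b s u w - Z w)%R < e%:E)%E.

(* Z is (a version of) the improper mean-square integral of Y over the line:
   the lower and upper limits of integration go to infinity independently. *)
Definition is_ms_integral_line Y Z : Prop :=
  cmeasurable setT Z /\
  exists J : R -> R -> Omega -> R[i],
    (forall a b, a < b -> is_ms_integral Y a b (J a b)) /\
    mean_square (fun w => J ab.1 ab.2 w - Z w)
      @[ab --> filter_prod (ninfty_nbhs R) (pinfty_nbhs R)] --> 0%E.

(* Z is a version of the integral of X(t) conj(f(t)) over the line. *)
Definition is_coefficient (X : R -> {RV P >-> R}) (f : R -> R[i]) Z : Prop :=
  is_ms_integral_line (fun t w => (X t w)%:C * (f t)^*%C) Z.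

End MeanSquareIntegral.

Section Wavelets.
Context {R : realType}.
Local Notation leb := (@lebesgue_measure R).

Definition refinement_mask (phi m0 : R -> R[i]) : Prop :=
  [/\ periodic m0 (pi *+ 2),
      square_integrable `[0, pi *+ 2] m0 &
      {ae leb, forall y, fourier phi y = m0 (y / 2) * fourier phi (y / 2)}].

Definition f_wavelet (phi : R -> R[i]) : Prop :=
  square_integrable setT phi /\
  [/\ fourier phi 0 != 0,
      ccontinuous_at (fourier phi) 0,
      {ae leb, forall y,
        (\esum_(k in [set: int])
           (cmod (fourier phi (y + (pi *+ 2) * k%:~R)) ^+ 2)%:E = 1)%E} &
      exists m0, refinement_mask phi m0].

(* psi is the inverse Fourier transform of g(y) := conj(m0(y/2 + pi)) e^{-iy/2}
   phi^(y/2), i.e. the element of L_2 that the Fourier transform maps to g.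
   The mask m0 is determined a.e. by the f-wavelet phi. *)
Definition m_wavelet (phi psi : R -> R[i]) : Prop :=
  exists2 m0, refinement_mask phi m0 &
    square_integrable setT psi /\
    {ae leb, forall y, fourier psi y =
      (m0 (y / 2 + pi))^*%C * cis (- (y / 2)) * fourier phi (y / 2)}.

Definition dilate_translate (f : R -> R[i]) (j : nat) (k : int) (x : R)
    : R[i] :=
  (2 `^ (j%:R / 2))%:C * f (2 ^+ j * x - k%:~R).

(* Only the values of Phi on [0, +oo[ are relevant. *)
Definition assumption_S (Phi : R -> R) (f : R -> R[i]) : Prop :=
  [/\ {in `[0, +oo[%R, forall x, 0 <= Phi x},
      {in `[0, +oo[%R &, {homo Phi : x y /~ x <= y}},
      {ae leb, forall x, cmod (f x) <= Phi `|x|} &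
      (\int[leb]_x (Phi `|x|)%:E < +oo)%E].

Definition C_S (Phi : R -> R) : \bar R :=
  (3%:E * (Phi 0)%:E + 4%:E * \int[leb]_(t in `[2^-1%R, +oo[) (Phi t)%:E)%E.

End Wavelets.

(* Main.v *)
Require Import Defs.
From HB Require Import structures.
From mathcomp Require Import all_boot all_order all_algebra.
From mathcomp Require Import all_classical all_reals all_analysis.
From mathcomp Require Import measurable_realfun zify ring lra.

Set Implicit Arguments.
Unset Strict Implicit.
Unset Printing Implicit Defensive.

Import Order.TTheory GRing.Theory Num.Theory numFieldNormedType.Exports.

Local Open Scope classical_set_scope.
Local Open Scope complex_scope.
Local Open Scope ring_scope.

(** Summation of the Fourier integral by a Fejer kernel gives, up to a constant
    factor, [rho t = int_0^oo rho^(z) cos(z t) dz].  Hence a quadratic form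
    [E (sum_i l_i X(t_i))^2] is the integral of [rho^] against
    [|sum_i l_i e^(i z t_i)|^2].  Applied to the Riemann sums that define the
    mean-square integrals, and passing to the limit under the integral in [z],
    this bounds [E |eta_jk|^2] by a constant times
    [int |rho^(z)| |psi_jk^(z)|^2 dz], and similarly for [xi_0k].

    The quadrature mirror identity [|m0(y)|^2 + |m0(y + pi)|^2 = 1] yields
    [|phi^(y)|^2 + |psi^(y)|^2 = |phi^(y/2)|^2] for almost every [y]; letting
    [y] tend to [0] gives [psi^(0) = 0].  The Lipschitz condition then reads
    [|psi^(y)|^2 <= L^2 |y|^alpha], so that
    [|psi_jk^(z)|^2 <= L^2 2^-j |z / 2^j|^alpha], and the series is dominated
    by a geometric one of ratio [2^(-alpha/2)]. *)

(** * Changes of variable and real integrals *)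

(** Only finiteness is claimed, so constants are spent freely. A coefficient is known solely as a
    mean-square limit, of Riemann sums and then of integrals over growing segments; each limit is
    crossed by [|z|^2 <= 2 |s|^2 + 2 |s - z|^2], whence the factors 2 and 4.

    The process is real and the wavelets are complex: the real and imaginary parts of a coefficient
    are treated as two separate real quadratic forms.

    Inversion requires an integrable [rho^]. The moment hypothesis controls it away from 0 only;
    near 0 it is bounded, because [rho] is integrable.

    The root mean square of [eta_jk] is of order [2^(-j/2) * 2^(-j alpha/2)]. The weight [2^(j/2)]
    cancels the first factor exactly, so that all the decay comes from the Lipschitz order, anchored
    at [psi^(0) = 0]. The wavelet relations hold almost everywhere while this is a value at a single
    point; continuity at 0 bridges the gap. *)

Section affine_change_of_variable.
Context {R : realType}.
Local Notation mu := (@lebesgue_measure R).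
Variables a b : R.
Hypothesis a_gt0 : 0 < a.
Local Notation aff := (fun x : R => a * x + b).

Lemma measurable_affine :
  measurable_fun setT (aff : measurableTypeR R -> measurableTypeR R).
Proof.
apply: continuous_measurable_fun => x.
by apply: cvgD; [apply: cvgM; [exact: cvg_cst|exact: cvg_id]|exact: cvg_cst].
Qed.

(** As functions of [A] both sides are measures with the same values on the intervals []x, y]], and
    these values determine Lebesgue measure. *)
Lemma lebesgue_measure_affine (A : set (measurableTypeR R)) : measurable A ->
  mu A = (a%:E * mu (aff @^-1` A))%E.
Proof.
move=> mA.
pose nu := mscale (NngNum (ltW a_gt0)) (pushforward mu (aff : measurableTypeR R -> measurableTypeR R)).
have mf := measurable_affine.
suff : mu A = nu mf A by [].
apply: lebesgue_measure_unique => // _ [[x y]] _ <-.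
transitivity (a%:E * mu (aff @^-1` `]x, y]%classic))%E; last by [].
have -> : aff @^-1` `]x, y]%classic = `](x - b) / a, (y - b) / a]%classic.
  apply/seteqP; split => z /=; rewrite !in_itv/= ltr_pdivrMr// ler_pdivlMr//;
    by rewrite mulrC ltrBlDr lerBrDr.
rewrite !lebesgue_measure_itv/= !lte_fin ltr_pM2r ?invr_gt0// ltrD2r.
case: ifPn => _; last by rewrite mule0.
rewrite -!EFinB -EFinM; congr (_%:E); field.
exact: lt0r_neq0.
Qed.

Lemma ge0_integral_affine (f : R -> \bar R) : measurable_fun setT f ->
  (forall x, 0 <= f x)%E ->
  (\int[mu]_x f x = a%:E * \int[mu]_x f (a * x + b)%R)%E.
Proof.
move=> mf f0.
pose g := (aff : measurableTypeR R -> measurableTypeR R).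
pose nu := mscale (NngNum (ltW a_gt0)) (pushforward mu g).
have mg := measurable_affine.
rewrite (eq_measure_integral (nu mg)); last first.
  by move=> A mA _; exact: lebesgue_measure_affine.
rewrite ge0_integral_mscale//=.
by rewrite ge0_integral_pushforward.
Qed.

Lemma integrable_affine (f : R -> \bar R) : mu.-integrable setT f ->
  mu.-integrable setT (fun x => f (a * x + b)).
Proof.
move=> /integrableP[mf fi]; apply/integrableP; split.
  exact: (measurableT_comp mf measurable_affine).
move: fi; rewrite ge0_integral_affine//; last exact: measurableT_comp.
have : (0 <= \int[mu]_x `|f (a * x + b)%R|)%E by exact: integral_ge0.
case: (\int[mu]_x _)%E => [r| |] //=; rewrite ?ltry//.
by rewrite gt0_muley// lte_fin.
Qed.

Lemma Rintegral_affine (f : R -> R) : mu.-integrable setT (EFin \o f) ->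
  \int[mu]_x f x = a * \int[mu]_x f (a * x + b).
Proof.
move=> fi; have mf := measurable_int mu fi.
have fi' := integrable_affine fi.
rewrite /Rintegral; transitivity (fine (a%:E * \int[mu]_x (f (a * x + b))%:E)%E).
  congr fine; rewrite (integralE mu setT (fun x => (f x)%:E)).
  rewrite (integralE mu setT (fun x => (f (a * x + b)%R)%:E)).
  rewrite muleBr//; last exact: integrable_add_def fi'.
  congr (_ - _)%E.
  - rewrite (ge0_integral_affine (f := ((EFin \o f)^\+)%E))//; last exact: measurable_funepos.
    by congr (_ * _)%E; apply: eq_integral => x _; rewrite !unlock.
  - rewrite (ge0_integral_affine (f := ((EFin \o f)^\-)%E))//; last exact: measurable_funeneg.
    by congr (_ * _)%E; apply: eq_integral => x _; rewrite !unlock.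
by rewrite fineM//; exact: integrable_fin_num.
Qed.

(** Carries the almost-everywhere relations of a wavelet from [y] to [y / 2], [y / 2 + pi] and
    [y + 2 pi k]. *)
Lemma ae_affine (Q : R -> Prop) : {ae mu, forall x, Q x} ->
  {ae mu, forall x, Q (a * x + b)}.
Proof.
move=> [N [mN N0 QN]]; exists (aff @^-1` N); split.
- by rewrite -[X in measurable X]setTI; exact: measurable_affine.
- have := lebesgue_measure_affine mN.
  rewrite N0 => /esym/eqP; rewrite mule_eq0 eqe (gt_eqF a_gt0)/= => /eqP //.
- by move=> x /= nQ; exact: QN.
Qed.

End affine_change_of_variable.

Section real_integrals.
Context {R : realType} {d : measure_display} {T : measurableType d}.
Variable m : {measure set T -> \bar R}.
Variables (D : set T) (mD : measurable D).

Lemma Rintegral_dominated_cvg (f_ : nat -> T -> R) (f g : T -> R) :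
  (forall n, measurable_fun D (f_ n)) ->
  (forall x, D x -> f_ n x @[n --> \oo] --> f x) ->
  m.-integrable D (EFin \o g) -> (forall n x, D x -> `|f_ n x| <= g x) ->
  \int[m]_(x in D) f_ n x @[n --> \oo] --> \int[m]_(x in D) f x.
Proof.
move=> mf_ f_f ig f_g.
have mf : measurable_fun D f by exact: measurable_fun_cvg mf_ f_f.
have [|||||h1 _ h3] := @dominated_convergence _ _ _ m D mD
    (fun n => EFin \o f_ n) (EFin \o f) (EFin \o g).
- by move=> n; exact/measurable_EFinP.
- exact/measurable_EFinP.
- apply: aeW => x Dx /=; apply: cvg_EFin; first exact: nearW.
  exact: f_f.
- exact: ig.
- by apply: aeW => x n Dx /=; rewrite lee_fin f_g.
- apply: fine_cvg; rewrite fineK//.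
  exact: integrable_fin_num.
Qed.

Lemma integrable_of_le (f g : T -> R) : measurable_fun D f ->
  m.-integrable D (EFin \o g) -> (forall x, D x -> `|f x| <= g x) ->
  m.-integrable D (EFin \o f).
Proof.
move=> mf ig fg; apply: (le_integrable mD _ _ ig); first exact/measurable_EFinP.
by move=> x Dx /=; rewrite lee_fin (le_trans (fg x Dx))// ler_norm.
Qed.

Lemma integrable_mulr_bounded (f h : T -> R) (M : R) :
  m.-integrable D (EFin \o f) -> measurable_fun D h ->
  (forall x, D x -> `|h x| <= M) ->
  m.-integrable D (EFin \o (fun x => f x * h x)).
Proof.
move=> fi mh hM.
have mf : measurable_fun D f by apply/measurable_EFinP; exact: measurable_int fi.
apply: (integrable_of_le (g := fun x => M * `|f x|)).
- exact: measurable_funM.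
- have := @integrableZl _ _ _ m D mD M _ (integrable_norm fi).
  by apply: eq_integrable.
- by move=> x Dx; rewrite normrM mulrC ler_wpM2r// hM.
Qed.

Lemma integrable_finite_integral (f : T -> R) : measurable_fun D f ->
  (\int[m]_(x in D) `|f x|%:E < +oo)%E -> m.-integrable D (EFin \o f).
Proof. by move=> mf fi; apply/integrableP; split => //; exact/measurable_EFinP. Qed.

End real_integrals.

Section trigonometric_transform.
Context {R : realType}.
Local Notation mu := (@lebesgue_measure R).

Lemma continuous_compM (h : R -> R) (a : R) : continuous h ->
  continuous (fun x => h (a * x)).
Proof.
move=> ch x; apply: continuous_comp; last exact: ch.
by apply: cvgM; [exact: cvg_cst|exact: cvg_id].
Qed.

Lemma continuous_compMr (h : R -> R) (a : R) : continuous h ->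
  continuous (fun x : R => h (x * a)).
Proof.
move=> ch x; apply: (@continuous_comp _ _ _ (fun y : R => y * a) h).
  by apply: cvgM; [exact: cvg_id|exact: cvg_cst].
exact: ch.
Qed.

Lemma continuous_transform (g h : R -> R) : continuous h ->
  (forall x, `|h x| <= 1) -> mu.-integrable setT (EFin \o g) ->
  continuous (fun z : R => \int[mu]_x (g x * h (z * x)) : R).
Proof.
move=> ch h1 gi z.
have zI : z \in (`]z - 1, z + 1[%classic : set R).
  by rewrite inE/= in_itv/= ltrBlDr ltrDl ltr01.
have mg : measurable_fun setT g by apply/measurable_EFinP; exact: measurable_int gi.
apply: (@continuity_under_integral R _ _ mu (fun z x => g x * h (z * x)) setT
  measurableT (z - 1) (z + 1) _ _ (fun x => `|g x|)) => //.
- move=> y _; apply: integrable_mulr_bounded => //.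
  by apply: continuous_measurable_fun; exact: continuous_compM.
- apply: aeW => x _ y _; apply: cvgM; first exact: cvg_cst.
  exact: continuous_compMr.
- exact: integrable_norm.
- by move=> y _; apply: aeW => x _; rewrite normrM ler_piMr.
Qed.

End trigonometric_transform.

(** * Fourier inversion *)

Section fejer_kernel.
Context {R : realType}.
Local Notation mu := (@lebesgue_measure R).

Lemma Rintegral_antiderivative (f G : R -> R) (a b : R) : a < b ->
  continuous f -> (forall x : R, is_derive x 1 G (f x)) ->
  \int[mu]_(x in `[a, b]) f x = G b - G a.
Proof.
move=> ab cf dG.
have cG : continuous G.
  move=> x; apply: differentiable_continuous; apply/derivable1_diffP.
  exact: (@ex_derive _ _ _ _ _ _ _ (dG x)).
rewrite /Rintegral (@continuous_FTC2 _ f G)//.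
- exact: continuous_subspaceT.
- split.
  + by move=> x _; exact: (@ex_derive _ _ _ _ _ _ _ (dG x)).
  + by apply: cvg_at_right_filter; exact: cG.
  + by apply: cvg_at_left_filter; exact: cG.
- by move=> x _; rewrite derive1E; exact: (@derive_val _ _ _ _ _ _ _ (dG x)).
Qed.

(* Half of the Fejer triangle: the weight lives on [0, 1], which is why the
   inversion formula below integrates over the half-line. *)
Definition tent : R -> R := (fun z : R => 1 - z : R) \_ `[0, 1].

Lemma tentE z : tent z = if 0 <= z <= 1 then 1 - z else 0.
Proof. by rewrite /tent patchE mem_setE in_itv. Qed.

Lemma tent_ge0 z : 0 <= tent z.
Proof. by rewrite tentE; case: ifPn => // /andP[]; lra. Qed.

Lemma tent_le1 z : tent z <= 1.
Proof. by rewrite tentE; case: ifPn => // /andP[]; lra. Qed.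

Lemma norm_tent_le z : `|tent z| <= \1_(`[0, 1]%classic : set R) z.
Proof.
rewrite ger0_norm ?tent_ge0// tentE indicE mem_setE in_itv/=.
by case: ifPn => //= /andP[]; lra.
Qed.

Lemma measurable_tent : measurable_fun setT tent.
Proof.
apply/(measurable_restrictT (fun z : R => 1 - z)) => //.
by apply: measurable_funB; [exact: measurable_cst|exact: measurable_id].
Qed.

Lemma integrable_tent : mu.-integrable setT (EFin \o tent).
Proof.
apply: integrable_of_le => //; last by move=> x _; exact: norm_tent_le.
  exact: measurable_tent.
exact: integrable_indic_itv.
Qed.

(** Taken as an integral rather than as [(1 - cos u) / u^2], so that continuity at 0 is a case of
    [continuous_transform]. *)
Definition fejer (u : R) : R := \int[mu]_z (tent z * cos (u * z)).

Lemma continuous_fejer : continuous fejer.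
Proof.
apply: continuous_transform integrable_tent; first exact: continuous_cos.
exact: cos_max.
Qed.

Lemma integrable_tent_cos u :
  mu.-integrable setT (EFin \o (fun z => tent z * cos (u * z))).
Proof.
apply: (@integrable_mulr_bounded _ _ _ mu _ measurableT _ _ 1) => //.
- exact: integrable_tent.
- apply: continuous_measurable_fun; apply: continuous_compM.
  exact: continuous_cos.
- by move=> x _; exact: cos_max.
Qed.

Lemma fejerE u : u != 0 -> fejer u = (1 - cos u) / u ^+ 2.
Proof.
(* [G] is the antiderivative found by integrating by parts once. *)
move=> u0; pose G z := (1 - z) * (sin (u * z) / u) - cos (u * z) / u ^+ 2.
transitivity (\int[mu]_(z in `[0, 1]) ((1 - z) * cos (u * z))).
  rewrite [RHS]Rintegral_mkcond; apply: eq_Rintegral => z _.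
  by rewrite tentE !patchE mem_setE in_itv/=; case: ifPn; rewrite ?mul0r.
have dG (x : R) : is_derive x 1 G ((1 - x) * cos (u * x)).
  rewrite /G; apply: is_derive_eq.
  by rewrite /GRing.scale/=; field.
rewrite (Rintegral_antiderivative _ _ dG)//.
- by rewrite /G !mulr1 mulr0 sin0 cos0 subrr; field.
- move=> x; apply: cvgM; first by apply: cvgB; [exact: cvg_cst|exact: cvg_id].
  by apply: continuous_compM; exact: continuous_cos.
Qed.

Lemma fejer_ge0 u : 0 <= fejer u.
Proof.
have [->|u0] := eqVneq u 0.
  by apply: Rintegral_ge0 => z _; rewrite mul0r cos0 mulr1 tent_ge0.
by rewrite fejerE// mulr_ge0 ?invr_ge0 ?sqr_ge0// subr_ge0 cos_le1.
Qed.

(** The sum of two bounds: [|fejer u| <= 1] from the integral, and [|fejer u| * u^2 <= 2] from the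
    closed form. *)
Lemma fejer_le u : `|fejer u| <= 3 * (oneDsqr u)^-1.
Proof.
have F1 : `|fejer u| <= 1.
  apply: (le_trans (le_normr_Rintegral _ _)) => //.
    exact: integrable_tent_cos.
  have -> : 1 = \int[mu]_z \1_(`[0, 1]%classic : set R) z.
    by rewrite /Rintegral integral_indic//= setIT lebesgue_measure_itv/= lte_fin ltr01 oppr0 addr0.
  apply: le_Rintegral => //.
  - exact: (integrable_norm (integrable_tent_cos u)).
  - exact: integrable_indic_itv.
  - move=> z _; rewrite normrM; apply: le_trans (norm_tent_le z).
    by rewrite ler_piMr// cos_max.
have D0 : 0 < oneDsqr u by rewrite (lt_le_trans ltr01)// oneDsqr_ge1.
rewrite ler_pdivlMr// /oneDsqr mulrDr mulr1.
have [u0|u0] := eqVneq u 0.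
  by rewrite u0 expr0n/= mulr0 addr0 -u0; lra.
suff : `|fejer u| * u ^+ 2 <= 2 by lra.
rewrite ger0_norm ?fejer_ge0// fejerE// divfK ?expf_neq0//.
by have := cos_max u; rewrite ler_norml => /andP[]; lra.
Qed.

Lemma integrable_oneDsqrV :
  mu.-integrable setT (EFin \o (fun u : R => (oneDsqr u)^-1)).
Proof.
apply/integrableP; split.
  apply/measurable_EFinP; apply: continuous_measurable_fun.
  exact: continuous_oneDsqrV.
under eq_integral do rewrite /= ger0_norm ?invr_ge0 ?(le_trans ler01) ?oneDsqr_ge1//.
rewrite (ge0_symfun_integralT (f := fun u : R => (oneDsqr u)^-1)).
- have -> : [set x : R | 0 <= x] = `[0, +oo[%classic.
    by apply/seteqP; split => x /=; rewrite in_itv/= andbT.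
  by rewrite integral0y_oneDsqr -EFinM ltry.
- by move=> x; rewrite invr_ge0 (le_trans ler01)// oneDsqr_ge1.
- exact: continuous_oneDsqrV.
- by move=> x /=; rewrite /oneDsqr sqrrN.
Qed.

Lemma integrable_fejer : mu.-integrable setT (EFin \o fejer).
Proof.
apply: (@integrable_of_le _ _ _ mu _ measurableT _ (fun u => 3 * (oneDsqr u)^-1)) => //.
- exact: continuous_measurable_fun continuous_fejer.
- have := @integrableZl _ _ _ mu setT measurableT 3 _ integrable_oneDsqrV.
  by apply: eq_integrable.
- by move=> u _; exact: fejer_le.
Qed.

(* The mass is not computed: inversion only needs it to be finite and nonzero. *)
Definition fejer_mass : R := \int[mu]_u fejer u.

Lemma fejer_mass_gt0 : 0 < fejer_mass.
Proof.
(* On this interval [cos] is nonpositive, so that [fejer u >= 1 / u^2 >= 1 / pi^2]. *)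
pose I : set R := `[pi / 2, pi]%classic.
have mI : measurable (I : set (measurableTypeR R)) by exact: measurable_itv.
have pi0 := pi_gt0 R.
apply: (@lt_le_trans _ _ (\int[mu]_u (pi ^- 2 * \1_I u))).
  rewrite RintegralZl//; last exact: integrable_indic_itv.
  have muI : mu I = (pi / 2)%:E.
    rewrite lebesgue_measure_itv/= lte_fin ifT; last by lra.
    by rewrite -EFinB; congr EFin; lra.
  rewrite mulr_gt0 ?invr_gt0 ?exprn_gt0// /Rintegral.
  rewrite (integral_indic mu measurableT mI) setIT.
  by rewrite [X in fine X]muI/=; lra.
apply: le_Rintegral => //.
- have := @integrableZl _ _ _ mu setT measurableT (pi ^- 2) _
    (integrable_indic_itv (pi / 2) pi true false).
  by apply: eq_integrable.
- exact: integrable_fejer.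
- move=> u _; rewrite indicE.
  have [|_] := boolP (u \in I); last by rewrite mulr0 fejer_ge0.
  rewrite inE /I/= in_itv/= => /andP[u1 u2].
  have u0 : 0 < u by lra.
  have c0 : cos u <= 0.
    have -> : cos u = - cos (pi - u) by rewrite cosB cospi sinpi; lra.
    by rewrite oppr_le0 cos_ge0_pihalf//; lra.
  rewrite mulr1 fejerE ?gt_eqF// ler_pdivlMr ?exprn_gt0//.
  rewrite mulrC ler_pdivrMr ?exprn_gt0//.
  have : u ^+ 2 <= pi ^+ 2 by rewrite lerXn2r ?nnegrE//; lra.
  move=> /le_trans; apply; rewrite ler_peMl ?exprn_ge0//; lra.
Qed.

End fejer_kernel.

Section cosine_inversion.
Context {R : realType}.
Local Notation mu := (@lebesgue_measure R).

(** Joint integrability comes from the product form: the integrand is at most [|u x| * |v y|]. *)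
Lemma Rintegral_Fubini (u v : R -> R) (k : R * R -> R) :
  mu.-integrable setT (EFin \o u) -> mu.-integrable setT (EFin \o v) ->
  measurable_fun setT (k : measurableTypeR R * measurableTypeR R -> R) ->
  (forall p, `|k p| <= 1) ->
  \int[mu]_x (\int[mu]_y (u x * v y * k (x, y))) =
  \int[mu]_y (\int[mu]_x (u x * v y * k (x, y))).
Proof.
move=> ui vi mk k1.
have mu_ : measurable_fun setT u by apply/measurable_EFinP; exact: measurable_int ui.
have mv_ : measurable_fun setT v by apply/measurable_EFinP; exact: measurable_int vi.
pose H (p : measurableTypeR R * measurableTypeR R) : R := u p.1 * v p.2 * k p.
have mH : measurable_fun setT H.
  apply: measurable_funM => //; apply: measurable_funM.
  - exact: (measurableT_comp mu_ measurable_fst).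
  - exact: (measurableT_comp mv_ measurable_snd).
have mk1 x : measurable_fun setT (fun y => k (x, y)).
  exact: (measurableT_comp mk (measurable_pair1 x)).
have mk2 y : measurable_fun setT (fun x => k (x, y)).
  exact: (measurableT_comp mk (measurable_pair2 y)).
have int1 x : mu.-integrable setT (EFin \o (fun y => H (x, y))).
  apply: (@integrable_mulr_bounded _ _ _ mu _ measurableT (fun y => u x * v y) _ 1) => //; last exact: mk1.
  have := @integrableZl _ _ _ mu setT measurableT (u x) _ vi.
  by apply: eq_integrable.
have int2 y : mu.-integrable setT (EFin \o (fun x => H (x, y))).
  apply: (@integrable_mulr_bounded _ _ _ mu _ measurableT (fun x => u x * v y) _ 1) => //; last exact: mk2.
  have := @integrableZr _ _ _ mu setT measurableT (v y) _ ui.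
  by apply: eq_integrable.
have iH : (mu \x mu)%E.-integrable setT (EFin \o H).
  apply/integrable12ltyP; first exact/measurable_EFinP.
  have vfin : (\int[mu]_y `|v y|%:E)%E \is a fin_num.
    by apply: integrable_fin_num => //; exact: integrable_norm vi.
  have V0 : (0 <= \int[mu]_y `|v y|%:E)%E by apply: integral_ge0.
  apply: (@le_lt_trans _ _ (\int[mu]_x (`|u x|%:E * \int[mu]_y `|v y|%:E))%E).
    apply: ge0_le_integral => //.
    - by move=> x1 Tx1; apply: integral_ge0.
    - apply: (measurable_fun_fubini_tonelli_F (fun p => `|(H p)%:E|%E)) => //.
      by apply: measurableT_comp => //; exact/measurable_EFinP.
    - apply: emeasurable_funM => //; apply/measurable_EFinP.
      exact: measurableT_comp.
    - move=> s Ts; rewrite -ge0_integralZl//; last first.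
        by apply/measurable_EFinP; exact: measurableT_comp.
      apply: ge0_le_integral => //.
      + by apply: measurableT_comp => //; exact: measurable_int (int1 s).
      + apply: emeasurable_funM => //; apply/measurable_EFinP.
        exact: measurableT_comp.
      + move=> r Tr; by rewrite /= lee_fin /H/= !normrM ler_piMr// mulr_ge0.
  rewrite -(fineK vfin); under eq_integral do rewrite -EFinM.
  have := @integrableZr _ _ _ mu setT measurableT (fine (\int[mu]_y `|v y|%:E)%E) _ (integrable_norm ui).
  move=> /integrableP[_]; apply: le_lt_trans.
  rewrite le_eqVlt; apply/orP; left; apply/eqP; apply: eq_integral => x _.
  by rewrite /= normrM normr_id [X in _ = (_ * X)%:E]ger0_norm// fine_ge0.
have := Fubini iH; rewrite /Rintegral => /(congr1 fine) E.
transitivity (fine (\int[mu]_x \int[mu]_y (H (x, y))%:E)%E).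
  congr fine; apply: eq_integral => x _; rewrite fineK//.
  by apply: integrable_fin_num => //; exact: int1.
rewrite E; congr fine; apply: eq_integral => y _; rewrite fineK//.
by apply: integrable_fin_num => //; exact: int2.
Qed.

Variable g : R -> R.
Hypothesis g_cont : continuous g.
Hypothesis g_int : mu.-integrable setT (EFin \o g).
Variable B : R.
Hypothesis g_le : forall x, `|g x| <= B.

(** The real part of the Fourier transform of [g], and all of it when [g] is even, as a covariance
    is. *)
Definition cos_transform (z : R) : R := \int[mu]_x (g x * cos (z * x)).

Lemma continuous_cos_transform : continuous cos_transform.
Proof.
by apply: continuous_transform => //; [exact: continuous_cos|exact: cos_max].
Qed.

Lemma integrable_shift_fejer (s a : R) :
  mu.-integrable setT (EFin \o (fun v => fejer v * g (s + a * v))).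
Proof.
apply: (@integrable_mulr_bounded _ _ _ mu _ measurableT _ _ B) => //.
  exact: integrable_fejer.
apply: continuous_measurable_fun => x.
apply: (@continuous_comp _ _ _ (fun v => s + a * v) g); last exact: g_cont.
by apply: cvgD; [exact: cvg_cst|apply: cvgM; [exact: cvg_cst|exact: cvg_id]].
Qed.

Lemma fejer_convolution (t a : R) : 0 < a ->
  a * \int[mu]_s (g s * fejer (a * (s - t))) =
  \int[mu]_v (fejer v * g (t + a^-1 * v)).
Proof.
move=> a0.
rewrite [RHS](Rintegral_affine (- (a * t)) a0); last exact: integrable_shift_fejer.
congr (_ * _); apply: eq_Rintegral => s _.
rewrite mulrBr mulrC; congr (_ * g _); field; exact: lt0r_neq0.
Qed.

Lemma integrable_g_fejer (t a : R) :
  mu.-integrable setT (EFin \o (fun s => g s * fejer (a * (s - t)))).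
Proof.
apply: (@integrable_mulr_bounded _ _ _ mu _ measurableT _ _ 3) => //.
- apply: continuous_measurable_fun => x.
  apply: (@continuous_comp _ _ _ (fun s => a * (s - t)) fejer).
    apply: cvgM; first exact: cvg_cst.
    by apply: cvgB; [exact: cvg_id|exact: cvg_cst].
  exact: continuous_fejer.
- move=> s _; apply: (le_trans (fejer_le _)).
  by rewrite ler_piMr// invf_le1 ?oneDsqr_ge1// (lt_le_trans ltr01)// oneDsqr_ge1.
Qed.

Lemma norm_cos_transform_le z :
  `|cos_transform z| <= \int[mu]_x `|g x|.
Proof.
have gc : mu.-integrable setT (EFin \o (fun x => g x * cos (z * x))).
  apply: (@integrable_mulr_bounded _ _ _ mu _ measurableT _ _ 1) => //.
    apply: continuous_measurable_fun; apply: continuous_compM.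
    exact: continuous_cos.
  by move=> x _; exact: cos_max.
apply: (le_trans (le_normr_Rintegral measurableT gc)).
apply: le_Rintegral => //.
- exact: integrable_norm gc.
- exact: integrable_norm.
- by move=> x _; rewrite normrM ler_piMr// cos_max.
Qed.

(** Put [z = a * w] and exchange the integrals: the tent is then integrated against
    [cos (a w t) * cos (a w s)], and the product formula turns this into half the sum of two Fejer
    kernels, centred at [t] and at [- t]. *)
Lemma tent_cos_transform (t a : R) : 0 < a ->
  \int[mu]_z (cos_transform z * cos (z * t) * tent (a^-1 * z)) =
  2^-1 * (\int[mu]_v (fejer v * g (t + a^-1 * v)) +
          \int[mu]_v (fejer v * g (- t + a^-1 * v))).
Proof.
move=> a0; have an0 := lt0r_neq0 a0.
have ccos (b : R) : measurable_fun setT (fun z : R => cos (z * b)).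
  apply: continuous_measurable_fun; apply: continuous_compMr.
  exact: continuous_cos.
rewrite (Rintegral_affine 0 a0); last first.
  have ti : mu.-integrable setT (EFin \o (fun z => tent (a^-1 * z))).
    have ai : 0 < a^-1 by rewrite invr_gt0.
    have -> : (fun z => tent (a^-1 * z)) = (fun z => tent (a^-1 * z + 0)).
      by apply/funext => z; rewrite addr0.
    exact: (integrable_affine 0 ai integrable_tent).
  under eq_fun do rewrite mulrC.
  apply: (@integrable_mulr_bounded _ _ _ mu _ measurableT _ _ (\int[mu]_x `|g x|) ti).
  - apply: measurable_funM; last exact: ccos.
    exact: continuous_measurable_fun continuous_cos_transform.
  - move=> x _; rewrite normrM (le_trans _ (norm_cos_transform_le x))//.
    by rewrite ler_piMr// cos_max.
transitivity (a * \int[mu]_w (\int[mu]_s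
    (tent w * g s * (cos (a * w * t) * cos (a * w * s))))).
  congr (_ * _); apply: eq_Rintegral => w _.
  rewrite addr0 mulrA mulVf// mul1r -mulrA mulrC -RintegralZl//.
    by apply: eq_Rintegral => s _; ring.
  apply: (@integrable_mulr_bounded _ _ _ mu _ measurableT _ _ 1) => //.
    apply: continuous_measurable_fun; apply: continuous_compM.
    exact: continuous_cos.
  by move=> x _; exact: cos_max.
have := @Rintegral_Fubini tent g (fun p => cos (a * p.1 * t) * cos (a * p.1 * p.2))
  integrable_tent g_int.
move=> -> /=; last 2 first.
- have mc : measurable_fun setT (cos : measurableTypeR R -> R).
    apply: continuous_measurable_fun; exact: continuous_cos.
  have m1 : measurable_fun setT
     (fun p : measurableTypeR R * measurableTypeR R => a * p.1).
    by apply: measurable_funM; [exact: measurable_cst|exact: measurable_fst].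
  apply: measurable_funM.
  + apply: (measurableT_comp mc); apply: measurable_funM; first exact: m1.
    exact: measurable_cst.
  + apply: (measurableT_comp mc); apply: measurable_funM; first exact: m1.
    exact: measurable_snd.
- by move=> p; rewrite normrM mulr_ile1// cos_max.
rewrite -!fejer_convolution// -mulrDr mulrCA; congr (_ * _).
rewrite -RintegralD//; try exact: integrable_g_fejer.
rewrite -RintegralZl//; last first.
  have := integrableD measurableT (integrable_g_fejer t a) (integrable_g_fejer (- t) a).
  by apply: eq_integrable.
apply: eq_Rintegral => s _.
have itc := @integrable_tent_cos R.
transitivity (\int[mu]_w (2^-1 * g s * (tent w * cos (a * (s - t) * w) +
   tent w * cos (a * (s + t) * w)))).
  apply: eq_Rintegral => w _.
  have -> : a * (s - t) * w = a * w * s - a * w * t by ring.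
  have -> : a * (s + t) * w = a * w * s + a * w * t by ring.
  by rewrite cosB cosD; field.
rewrite RintegralZl//; last first.
  have := integrableD measurableT (itc (a * (s - t))) (itc (a * (s + t))).
  by apply: eq_integrable.
rewrite RintegralD// opprK /fejer; ring.
Qed.

Hypothesis g_even : forall x, g (- x) = g x.
Hypothesis cos_transform_int : mu.-integrable setT (EFin \o cos_transform).

Lemma cvg_tent (z : R) : 0 <= z -> tent (n.+1%:R^-1 * z) @[n --> \oo] --> (1 : R).
Proof.
move=> z0.
have h : (n.+1%:R^-1 * z) @[n --> \oo] --> (0 : R).
  by rewrite -(mul0r z); apply: cvgM; [exact: cvg_harmonic|exact: cvg_cst].
apply/cvgrPdist_le => e e0.
move/cvgrPdist_le : h => /(_ e e0); apply: filterS => n /=.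
have : 0 <= n.+1%:R^-1 * z by rewrite mulr_ge0.
move: (_ * z) => x x0; rewrite sub0r normrN (ger0_norm x0) => xe.
rewrite tentE; case: ifPn => [_|]; first by rewrite opprB addrC subrK ger0_norm.
rewrite x0/= -ltNge => x1; rewrite subr0 normr1; lra.
Qed.

(** The tent-weighted integrals with scale [n.+1] have two limits. As Fejer averages of a bounded
    continuous function they tend to [fejer_mass * g t]; dominated by [|cos_transform|], they tend
    to the unweighted integral over the half-line, since the tent vanishes at negative arguments. *)
Theorem cos_inversion (t : R) : fejer_mass * g t =
  \int[mu]_(z in `[0%R, +oo[) (cos_transform z * cos (z * t)).
Proof.
have h1 : \int[mu]_z (cos_transform z * cos (z * t) * tent (n.+1%:R^-1 * z))
   @[n --> \oo] --> fejer_mass * g t.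
  have hs (s : R) : \int[mu]_v (fejer v * g (s + n.+1%:R^-1 * v)) @[n --> \oo] -->
      \int[mu]_v (fejer v * g s).
    apply: (@Rintegral_dominated_cvg _ _ _ mu _ measurableT _ _ (fun v => `|fejer v| * B)) => //.
    - move=> n; apply/measurable_EFinP.
      exact: measurable_int (integrable_shift_fejer _ _).
    - move=> v _; apply: cvgM; first exact: cvg_cst.
      apply: (cvg_comp (fun n => s + n.+1%:R^-1 * v) g _ (@g_cont s)).
      have : (s + n.+1%:R^-1 * v) @[n --> \oo] --> s + 0 * v.
        apply: cvgD; first exact: cvg_cst.
        by apply: cvgM; [exact: cvg_harmonic|exact: cvg_cst].
      by rewrite mul0r addr0.
    - have := integrableZr measurableT B (integrable_norm integrable_fejer).
      by apply: eq_integrable.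
    - by move=> n v _; rewrite normrM ler_wpM2l.
  (* Evenness of [g] merges the contributions of [t] and [- t]. *)
  have -> : fejer_mass * g t = 2^-1 * (\int[mu]_v (fejer v * g t) +
      \int[mu]_v (fejer v * g (- t))).
    rewrite g_even RintegralZr//; last exact: integrable_fejer.
    by rewrite /fejer_mass; field.
  under eq_fun do rewrite tent_cos_transform ?invrK//.
  by apply: cvgM; [exact: cvg_cst|apply: cvgD; exact: hs].
have h2 : \int[mu]_z (cos_transform z * cos (z * t) * tent (n.+1%:R^-1 * z))
   @[n --> \oo] --> 
  \int[mu]_(z in `[0%R, +oo[) (cos_transform z * cos (z * t)).
  rewrite [X in _ --> X]Rintegral_mkcond.
  apply: (@Rintegral_dominated_cvg _ _ _ mu _ measurableT _ _ (fun z => `|cos_transform z|)) => //.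
  - move=> n; apply: measurable_funM; first apply: measurable_funM.
    + exact: continuous_measurable_fun continuous_cos_transform.
    + apply: continuous_measurable_fun; apply: continuous_compMr.
      exact: continuous_cos.
    + have -> : (fun z : R => tent (n.+1%:R^-1 * z)) =
          tent \o (fun z : R => n.+1%:R^-1 * z + 0).
        by apply/funext => z /=; rewrite addr0.
      exact: (measurableT_comp measurable_tent (measurable_affine _ 0)).
  - move=> z _; rewrite patchE mem_setE in_itv/= andbT.
    have [z0|z0] := leP 0 z.
      rewrite -[X in _ --> X]mulr1; apply: cvgM; first exact: cvg_cst.
      exact: cvg_tent.
    under eq_fun do rewrite tentE pmulr_rge0 ?invr_gt0 ?ltr0n// leNgt z0/= mulr0.
    exact: cvg_cst.
  - exact: integrable_norm.
  - move=> n z _; rewrite !normrM -mulrA ler_piMr// mulr_ile1// ?cos_max//.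
    by rewrite ger0_norm ?tent_ge0 ?tent_le1.
exact: (cvg_unique _ h1 h2).
Qed.

End cosine_inversion.

(** * Riemann sums *)

Section riemann_sums.
Context {R : realType}.
Local Notation mu := (@lebesgue_measure R).

Lemma segment_uniform_continuity (g : R -> R) (a b e : R) :
  continuous g -> 0 < e -> exists2 dl : R, 0 < dl &
    forall x y, a <= x <= b -> `|x - y| < dl -> `|g x - g y| <= e.
Proof.
move=> cg e0.
have e20 : 0 < e / 2 by rewrite divr_gt0.
(* Compactness in covering form: an estimate that holds near each point of the segment for all small
   [dl] holds on the whole segment for some [dl]. *)
have := @segment_compact R a b.
move/compact_near_coveringP => /(_ R (at_right 0)
  (fun dl x => forall y, `|x - y| < dl -> `|g x - g y| <= e)) H.
have {H} : \forall dl \near at_right (0 : R), `[a, b]%classic `<=`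
    (fun x => forall y, `|x - y| < dl -> `|g x - g y| <= e).
  apply: H => x _.
  have /cvgrPdist_lt/(_ _ e20)/nbhs_ballP[r /= r0 rg] := cg x.
  have r20 : 0 < r / 2 by rewrite divr_gt0.
  (* With half radii, [x'] is within [r / 2] of [x] and [y] within [r / 2] of [x'], so both lie in
     the ball of radius [r]. *)
  exists (ball x (r / 2), [set dl | dl < r / 2]); first split.
  - exact: nbhsx_ballx.
  - exact: nbhs_right_lt.
  - move=> [x' dl] /= [xx' dlr] y x'y.
    have h1 : `|g x - g x'| < e / 2.
      by apply: rg; rewrite /= /ball/= (lt_trans xx')//; lra.
    have h2 : `|g x - g y| < e / 2.
      apply: rg; rewrite /= /ball/=.
      have -> : x - y = (x - x') + (x' - y) by ring.
      apply: (le_lt_trans (ler_normD _ _)).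
      by rewrite [ltRHS](splitr r) ltrD// (lt_trans x'y).
    have -> : g x' - g y = (g x - g y) - (g x - g x') by ring.
    by apply: (le_trans (ler_normB _ _)); lra.
move=> H.
have {}H : \forall dl \near at_right (0 : R), 0 < dl /\
    (`[a, b]%classic `<=` (fun x => forall y, `|x - y| < dl -> `|g x - g y| <= e)).
  by near=> dl; split; [|near: dl].
have [dl [dl0 Pdl]] := filter_ex H.
by exists dl => // x y xab; apply: Pdl; rewrite /= in_itv.
Unshelve. all: by end_near. Qed.

Lemma continuous_integrable_itv (g : R -> R) (a b : R) : continuous g ->
  mu.-integrable `[a, b] (EFin \o g).
Proof.
move=> cg; apply: continuous_compact_integrable; first exact: segment_compact.
exact: continuous_subspaceT.
Qed.

(** Every point of a cell is within [h] of its left endpoint, so a cell contributes at most [h * e];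
    the induction peels off the rightmost cell. *)
Lemma riemann_sum_error (g : R -> R) (a h e : R) (n : nat) : 0 < h ->
  continuous g ->
  (forall x y, a <= x <= a + n%:R * h -> `|x - y| <= h -> `|g x - g y| <= e) ->
  `|\int[mu]_(x in `[a, a + n%:R * h]) g x - \sum_(i < n) h * g (a + i%:R * h)|
    <= n%:R * h * e.
Proof.
move=> h0 cg; elim: n => [|n ih] ge.
  by rewrite !mul0r addr0 set_itv1 Rintegral_set1 big_ord0 subrr normr0.
set c := a + n%:R * h.
have cE : a + n.+1%:R * h = c + h by rewrite -addn1 natrD /c; ring.
have nh0 : 0 <= n%:R * h by rewrite mulr_ge0// ltW.
have ac : a <= c by rewrite /c lerDl.
have cI := continuous_integrable_itv a (c + h) cg.
have := @Rintegral_itvB R g (BLeft a) (BRight (c + h)) c cI.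
rewrite !bnd_simp => /(_ ac); rewrite lerDl => /(_ (ltW h0)) E.
rewrite cE in ge *; rewrite -(subrK (\int[mu]_(x in `[a, c]) g x) (\int[mu]_(x in `[a, c + h]) g x)) E.
rewrite big_ord_recr/= -/c.
have {}ih := ih _.
have cI2 : mu.-integrable `]c, c + h] (EFin \o g).
  apply: (@integrableS _ _ _ mu `[c, c + h]%classic) => //.
    exact: subset_itv_oc_cc.
  exact: continuous_integrable_itv.
have cst_int (k : R) : mu.-integrable `]c, c + h] (EFin \o (fun=> k)).
  apply: (@integrableS _ _ _ mu `[c, c + h]%classic) => //.
    exact: subset_itv_oc_cc.
  by apply: continuous_integrable_itv; exact: cst_continuous.
have mI : measurable (`]c, c + h]%classic : set (measurableTypeR R)).
  exact: measurable_itv.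
have muI (k : R) : \int[mu]_(x in `]c, c + h]) k = k * h.
  have muE : mu `]c, c + h]%classic = h%:E.
    rewrite lebesgue_measure_itv/= lte_fin ltrDl h0 -EFinB.
    by rewrite addrAC subrr add0r.
  by rewrite Rintegral_cst; [rewrite [X in fine X]muE|exact: measurable_itv].
have step : `|\int[mu]_(x in `]c, c + h]) g x - h * g c| <= h * e.
  rewrite [h * g c]mulrC -muI -RintegralB//.
  have Bi : mu.-integrable `]c, c + h] (EFin \o (fun x => g x - g c)).
    have := integrableB mI cI2 (cst_int (g c)).
    by apply: eq_integrable.
  apply: (le_trans (le_normr_Rintegral _ Bi)) => //.
  rewrite [h * e]mulrC -muI; apply: le_Rintegral => //.
    exact: integrable_norm Bi.
  move=> x /=; rewrite in_itv/= => /andP[cx xc]; apply: ge.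
    by rewrite xc andbT (le_trans ac)// ltW.
  by rewrite ger0_norm; lra.
have -> : forall u v w s : R, u + v - (s + w) = (u - w) + (v - s) by move=> *; ring.
apply: (le_trans (ler_normD _ _)).
have -> : n.+1%:R * h * e = h * e + n%:R * h * e by rewrite -addn1 natrD; ring.
rewrite lerD// ih// => x y /andP[x1 x2]; apply: ge.
by rewrite x1/= (le_trans x2)// lerDl ltW.
Qed.

Lemma cvg_riemann_sum (g : R -> R) (a b : R) : a < b -> continuous g ->
  \sum_(i < n.+1) ((b - a) / n.+1%:R) * g (a + i%:R * ((b - a) / n.+1%:R))
    @[n --> \oo] --> \int[mu]_(x in `[a, b]) g x.
Proof.
move=> ab cg; have ba0 : 0 < b - a by rewrite subr_gt0.
apply/cvgrPdist_le => e e0.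
have e10 : 0 < e / (b - a) by rewrite divr_gt0.
have [dl dl0 gdl] := segment_uniform_continuity a b cg e10.
have : ((b - a) / n.+1%:R) @[n --> \oo] --> (0 : R).
  by rewrite -(mulr0 (b - a)); apply: cvgM; [exact: cvg_cst|exact: cvg_harmonic].
move/cvgrPdist_lt => /(_ _ dl0); apply: filterS => n.
set h := (b - a) / n.+1%:R.
have h0 : 0 < h by rewrite divr_gt0.
rewrite sub0r normrN gtr0_norm// => hdl.
have bE : b = a + n.+1%:R * h by rewrite /h mulrCA divff// mulr1 addrC subrK.
rewrite {1}bE; apply: (le_trans (@riemann_sum_error g a h (e / (b - a)) n.+1 h0 cg _)).
  by move=> x y; rewrite -bE => xab xy; apply: gdl => //; exact: le_lt_trans hdl.
suff -> : n.+1%:R * h * (e / (b - a)) = e by [].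
have n0 : n.+1%:R != 0 :> R by rewrite pnatr_eq0.
have ba : b - a != 0 by rewrite gt_eqF.
rewrite /h; set N := n.+1%:R in n0 *; set D := b - a in ba *.
by field; apply/andP; split.
Qed.

End riemann_sums.

(** * Mean-square bounds *)

Section Rintegral_sums.
Context {R : realType} {d : measure_display} {T : measurableType d}.
Variable m : {measure set T -> \bar R}.
Variables (D : set T) (mD : measurable D).

Lemma integrable_Rsum (I : Type) (s : seq I) (F : I -> T -> R) :
  (forall i, m.-integrable D (EFin \o F i)) ->
  m.-integrable D (EFin \o (fun x => \sum_(i <- s) F i x)).
Proof.
move=> Fi.
have -> : EFin \o (fun x => \sum_(i <- s) F i x) =
    (fun x => \sum_(i <- s) (EFin \o F i) x)%E.
  by apply/funext => x /=; rewrite sumEFin.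
by apply: integrable_sum => //; move=> i _; exact: Fi.
Qed.

Lemma Rintegral_sum (I : Type) (s : seq I) (F : I -> T -> R) :
  (forall i, m.-integrable D (EFin \o F i)) ->
  \int[m]_(x in D) (\sum_(i <- s) F i x) = \sum_(i <- s) \int[m]_(x in D) F i x.
Proof.
move=> Fi; elim: s => [|i s ih].
  rewrite big_nil; under eq_Rintegral do rewrite big_nil.
  by rewrite Rintegral_cst// mul0r.
rewrite big_cons -ih -RintegralD//; last exact: integrable_Rsum.
by apply: eq_Rintegral => x _; rewrite big_cons.
Qed.

Lemma integrable_scale (k : R) (f : T -> R) : m.-integrable D (EFin \o f) ->
  m.-integrable D (EFin \o (fun x => k * f x)).
Proof.
by move=> fi; have := integrableZl mD k fi; apply: eq_integrable.
Qed.

Lemma integrable_add (f g : T -> R) : m.-integrable D (EFin \o f) ->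
  m.-integrable D (EFin \o g) -> m.-integrable D (EFin \o (fun x => f x + g x)).
Proof.
by move=> fi gi; have := integrableD mD fi gi; apply: eq_integrable.
Qed.

End Rintegral_sums.

Section second_order_process.
Context {R : realType} {d : measure_display} {Omega : measurableType d}.
Variable P : probability Omega R.
Local Notation mu := (@lebesgue_measure R).
Variables (X : R -> {RV P >-> R}) (rho : R -> R).
Hypothesis X_stationary : stationary_with_covariance X rho.
Hypothesis X_second : forall t, ('E_P[fun w => (`|X t w| ^+ 2)%R] < +oo)%E.

Lemma integrable_product (t s : R) :
  P.-integrable setT (EFin \o (fun w => X t w * X s w)).
Proof.
have sq u : P.-integrable setT (EFin \o (fun w => X u w ^+ 2)).
  apply/integrableP; split.
    by apply/measurable_EFinP; apply: measurable_funX.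
  have := X_second u; rewrite unlock; congr (_ < _)%E.
  by apply: eq_integral => w _; rewrite /= normrX.
apply: (@integrable_of_le _ _ _ P _ measurableT _ (fun w => X t w ^+ 2 + X s w ^+ 2)).
- exact: measurable_funM.
- exact: integrable_add.
- move=> w _; rewrite normrM -(real_normK (num_real (X t w))) -(real_normK (num_real (X s w))).
  have := sqr_ge0 (`|X t w| - `|X s w|).
  have := mulr_ge0 (normr_ge0 (X t w)) (normr_ge0 (X s w)).
  by rewrite sqrrB; lra.
Qed.

Lemma stationary_productE (t s : R) : \int[P]_w (X t w * X s w) = rho (t - s).
Proof. by have := X_stationary t s; rewrite unlock /Rintegral => ->. Qed.

Lemma covariance_even (t : R) : rho (- t) = rho t.
Proof.
have e1 := stationary_productE 0 t; have e2 := stationary_productE t 0.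
rewrite sub0r in e1; rewrite subr0 in e2; rewrite -e1 -e2.
by apply: eq_Rintegral => w _; rewrite mulrC.
Qed.

(** Here [|x y| <= (x^2 + y^2) / 2] does the work of Cauchy-Schwarz, because stationarity gives both
    variables the second moment [rho 0]. It supplies the bound [B] of the inversion theorem. *)
Lemma covariance_le (t : R) : `|rho t| <= rho 0.
Proof.
have xx u : rho 0 = \int[P]_w (X u w * X u w) by rewrite stationary_productE subrr.
have -> : rho 0 = \int[P]_w (2^-1 * (X t w * X t w + X 0 w * X 0 w)).
  rewrite RintegralZl//; last by apply: integrable_add => //; exact: integrable_product.
  by rewrite RintegralD//; [rewrite -!xx; field|exact: integrable_product..].
rewrite -[t]subr0 -stationary_productE.
apply: (le_trans (le_normr_Rintegral measurableT (integrable_product _ _))).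
apply: le_Rintegral => //.
- exact: integrable_norm (integrable_product t 0).
- by apply: integrable_scale => //; apply: integrable_add => //; exact: integrable_product.
- move=> w _; rewrite subr0 ler_norml.
  have := sqr_ge0 (X t w - X 0 w); have := sqr_ge0 (X t w + X 0 w).
  by rewrite sqrrB sqrrD -!expr2; lra.
Qed.

Lemma quadratic_form_covariance (n : nat) (l t : nat -> R) :
  \int[P]_w ((\sum_(i < n) l i * X (t i) w) ^+ 2) =
  \sum_(i < n) \sum_(j < n) l i * l j * rho (t i - t j).
Proof.
transitivity (\int[P]_w (\sum_(i < n) \sum_(j < n)
    (l i * l j) * (X (t i) w * X (t j) w))).
  apply: eq_Rintegral => w _; rewrite expr2 big_distrlr/=.
  by apply: eq_bigr => i _; apply: eq_bigr => j _; ring.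
rewrite Rintegral_sum//; last first.
  move=> i; apply: integrable_Rsum => // j; apply: integrable_scale => //.
  exact: integrable_product.
apply: eq_bigr => i _; rewrite Rintegral_sum//; last first.
  by move=> j; apply: integrable_scale => //; exact: integrable_product.
apply: eq_bigr => j _; rewrite RintegralZl ?stationary_productE//.
exact: integrable_product.
Qed.

Hypothesis rho_cont : continuous rho.
Hypothesis rho_int : mu.-integrable setT (EFin \o rho).
Local Notation r := (cos_transform rho).
Hypothesis r_int : mu.-integrable setT (EFin \o r).

Lemma quadratic_form_spectral (n : nat) (l t : nat -> R) :
  fejer_mass * \int[P]_w ((\sum_(i < n) l i * X (t i) w) ^+ 2) =
  \int[mu]_(z in `[0, +oo[) (r z *
    ((\sum_(i < n) l i * cos (z * t i)) ^+ 2 + (\sum_(i < n) l i * sin (z * t i)) ^+ 2)).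
Proof.
rewrite quadratic_form_covariance.
have inv := cos_inversion rho_cont rho_int covariance_le covariance_even r_int.
have r_int0 : mu.-integrable `[0, +oo[ (EFin \o r).
  by apply: (@integrableS _ _ _ mu setT).
have rci u : mu.-integrable `[0, +oo[ (EFin \o (fun z => r z * cos (z * u))).
  apply: (@integrable_mulr_bounded _ _ _ mu _ _ _ _ 1) => //.
    apply: measurable_funTS; apply: continuous_measurable_fun.
    by apply: continuous_compMr; exact: continuous_cos.
  by move=> x _; exact: cos_max.
rewrite mulr_sumr; under eq_bigr do rewrite mulr_sumr.
transitivity (\sum_(i < n) \sum_(j < n)
   \int[mu]_(z in `[0, +oo[) ((l i * l j) * (r z * cos (z * (t i - t j))))).
  apply: eq_bigr => i _; apply: eq_bigr => j _.
  by rewrite RintegralZl// -inv; ring.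
under eq_bigr => i _.
  rewrite -Rintegral_sum//; last by move=> j; exact: integrable_scale.
  over.
rewrite -Rintegral_sum//; last first.
  by move=> i; apply: integrable_Rsum => // j; exact: integrable_scale.
(* Since [cos (z (t_i - t_j))] is [cos cos + sin sin], the double sum is a sum of two squares. *)
apply: eq_Rintegral => z _; rewrite !expr2 !big_distrlr/= -big_split/= mulr_sumr.
apply: eq_bigr => i _; rewrite -big_split/= mulr_sumr; apply: eq_bigr => j _.
by rewrite mulrBr cosB; ring.
Qed.

Lemma measurable_trig_sum (h : R -> R) (n : nat) (l t : nat -> R) : continuous h ->
  measurable_fun setT (fun z : R => \sum_(i < n) l i * h (z * t i)).
Proof.
move=> ch; apply: measurable_sum => i; apply: measurable_funM => //.
by apply: continuous_measurable_fun; exact: continuous_compMr.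
Qed.

Lemma norm_trig_sum (h : R -> R) (n : nat) (l t : nat -> R) z :
  (forall x, `|h x| <= 1) ->
  `|\sum_(i < n) l i * h (z * t i)| <= \sum_(i < n) `|l i|.
Proof.
move=> h1; apply: (le_trans (ler_norm_sum _ _ _)); apply: ler_sum => i _.
by rewrite normrM ler_piMr.
Qed.

(** Replacing [r] by [|r|] makes the bound monotone in the trigonometric factor, as
    [spectral_energy_le] requires. *)
Lemma quadratic_form_le (n : nat) (l t : nat -> R) :
  \int[P]_w ((\sum_(i < n) l i * X (t i) w) ^+ 2) <=
  fejer_mass^-1 * \int[mu]_(z in `[0, +oo[) (`|r z| *
    ((\sum_(i < n) l i * cos (z * t i)) ^+ 2 + (\sum_(i < n) l i * sin (z * t i)) ^+ 2)).
Proof.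
rewrite ler_pdivlMl ?fejer_mass_gt0// quadratic_form_spectral.
pose K := \sum_(i < n) `|l i|.
pose Q (z : R) := (\sum_(i < n) l i * cos (z * t i)) ^+ 2 +
  (\sum_(i < n) l i * sin (z * t i)) ^+ 2.
have Q0 z : 0 <= Q z by rewrite addr_ge0 ?sqr_ge0.
have K0 : 0 <= K by apply: sumr_ge0.
have QK z : `|Q z| <= K ^+ 2 + K ^+ 2.
  have cK := norm_trig_sum n l t z (@cos_max R).
  have sK := norm_trig_sum n l t z (@sin_max R).
  rewrite ger0_norm// /Q; apply: lerD; rewrite -[leLHS]real_normK ?num_real//;
    by rewrite lerXn2r ?nnegrE.
have mQ : measurable_fun setT Q.
  apply: measurable_funD; apply: measurable_funX.
  - exact: (measurable_trig_sum n l t (@continuous_cos R)).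
  - exact: (measurable_trig_sum n l t (@continuous_sin R)).
have ri0 : mu.-integrable `[0, +oo[ (EFin \o r).
  by apply: (@integrableS _ _ _ mu setT).
apply: le_Rintegral => //.
- apply: (@integrable_mulr_bounded _ _ _ mu _ _ _ Q _ ri0) => //.
  exact: measurable_funTS.
- apply: (@integrable_mulr_bounded _ _ _ mu _ _ (fun z => `|r z|) Q (K ^+ 2 + K ^+ 2)) => //.
    exact: integrable_norm ri0.
  exact: measurable_funTS.
- by move=> z _; rewrite ler_wpM2r ?ler_norm//; exact: Q0.
Qed.

End second_order_process.

(** * Spectral energy and its limits *)

Section spectral_energy.
Context {R : realType}.
Local Notation mu := (@lebesgue_measure R).
Variable r : R -> R.
Hypothesis r_int : mu.-integrable setT (EFin \o r).

(** The two squares add up to the squared modulus at [z] of the Fourier transform of the real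
    function [g] cut off to [D]. The half-line and the factor [fejer_mass^-1] are those of the
    inversion formula. *)
Definition spectral_energy (D : set R) (g : R -> R) : R :=
  fejer_mass^-1 * \int[mu]_(z in `[0, +oo[) (`|r z| *
    ((\int[mu]_(x in D) (g x * cos (z * x))) ^+ 2 +
     (\int[mu]_(x in D) (g x * sin (z * x))) ^+ 2)).

Let r_int0 : mu.-integrable `[0, +oo[ (EFin \o (fun z => `|r z|)).
Proof.
by apply: (@integrableS _ _ _ mu setT) => //; exact: (integrable_norm r_int).
Qed.

Let mr : measurable_fun (`[0, +oo[%classic : set R) (fun z : R => `|r z|).
Proof. by apply/measurable_EFinP; exact: measurable_int r_int0. Qed.

(** Dominated convergence in [z] with majorant [2 K^2 |r|]. It serves both limits: mesh tending to
    0, and segments growing to the line. *)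
Lemma cvg_spectral (c_ s_ : nat -> R -> R) (c s : R -> R) (K : R) :
  (forall n, measurable_fun setT (c_ n)) -> (forall n, measurable_fun setT (s_ n)) ->
  (forall n z, `|c_ n z| <= K) -> (forall n z, `|s_ n z| <= K) ->
  (forall z, c_ n z @[n --> \oo] --> c z) -> (forall z, s_ n z @[n --> \oo] --> s z) ->
  fejer_mass^-1 * \int[mu]_(z in `[0, +oo[) (`|r z| * (c_ n z ^+ 2 + s_ n z ^+ 2))
    @[n --> \oo] -->
  fejer_mass^-1 * \int[mu]_(z in `[0, +oo[) (`|r z| * (c z ^+ 2 + s z ^+ 2)).
Proof.
move=> mc ms cK sK cc ss; apply: cvgM; first exact: cvg_cst.
have sq (x : R) : `|x| <= K -> x ^+ 2 <= K ^+ 2.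
  move=> xK; rewrite -real_normK ?num_real// lerXn2r ?nnegrE//.
  exact: le_trans xK.
apply: (@Rintegral_dominated_cvg _ _ _ mu _ _ _ _ (fun z => (K ^+ 2 + K ^+ 2) * `|r z|)) => //.
- move=> n; apply: measurable_funM; first exact: mr.
  apply: measurable_funTS; apply: measurable_funD; apply: measurable_funX.
    exact: mc.
  exact: ms.
- move=> z _; apply: cvgM; first exact: cvg_cst.
  apply: cvgD.
  + exact: (cvg_comp _ _ (cc z) (@exprn_continuous R 2 (c z))).
  + exact: (cvg_comp _ _ (ss z) (@exprn_continuous R 2 (s z))).
- exact: integrable_scale.
- move=> n z _; rewrite normrM normr_id mulrC ler_wpM2r// ger0_norm.
    by apply: lerD; exact: sq.
  by rewrite addr_ge0 ?sqr_ge0.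
Qed.

Lemma cvg_riemann_energy (g : R -> R) (a b : R) : a < b -> continuous g ->
  let h n := (b - a) / n.+1%:R in let u n i := a + i%:R * h n in
  fejer_mass^-1 * \int[mu]_(z in `[0, +oo[) (`|r z| *
    ((\sum_(i < n.+1) h n * g (u n i) * cos (z * u n i)) ^+ 2 +
     (\sum_(i < n.+1) h n * g (u n i) * sin (z * u n i)) ^+ 2))
    @[n --> \oo] --> spectral_energy `[a, b] g.
Proof.
move=> ab cg h u.
have cgn : continuous (fun x => `|g x|).
  by move=> x; apply: (@continuous_comp _ _ _ g (fun y => `|y|)); [exact: cg|exact: norm_continuous].
(* [m] is a maximum point of [|g|] on the segment; all the trigonometric sums are then at most
   [(b - a) * |g m|], the constant [K] of [cvg_spectral]. *)
have [m _ gm] := EVT_max (ltW ab) (continuous_subspaceT cgn).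
have h0 n : 0 < h n by rewrite divr_gt0 ?subr_gt0.
have uab n (i : 'I_n.+1) : u n i \in `[a, b]%R.
  rewrite in_itv/= /u lerDl mulr_ge0 ?(ltW (h0 _))//= -lerBrDl.
  rewrite /h mulrCA ler_piMr ?subr_ge0 ?(ltW ab)// ler_pdivrMr ?ltr0n// mul1r.
  by rewrite ler_nat ltnW.
have bound (q : R -> R) n z : (forall x, `|q x| <= 1) ->
    `|\sum_(i < n.+1) h n * g (u n i) * q (z * u n i)| <= (b - a) * `|g m|.
  move=> q1; apply: (le_trans (ler_norm_sum _ _ _)).
  apply: (@le_trans _ _ (\sum_(i < n.+1) h n * `|g m|)).
    apply: ler_sum => i _; rewrite normrM normrM (gtr0_norm (h0 _)) -mulrA.
    rewrite ler_wpM2l ?(ltW (h0 _))// (@le_trans _ _ (`|g (u n i)|))//.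
      by rewrite ler_piMr.
    exact: gm.
  have N0 : n.+1%:R != 0 :> R by rewrite pnatr_eq0.
  by rewrite sumr_const card_ord -mulr_natl /h mulrA mulrCA divff// mulr1.
have lim (q : R -> R) z : continuous q ->
    \sum_(i < n.+1) h n * g (u n i) * q (z * u n i) @[n --> \oo] -->
    \int[mu]_(x in `[a, b]) (g x * q (z * x)).
  move=> cq; under eq_fun do under eq_bigr do rewrite -mulrA.
  apply: (@cvg_riemann_sum R (fun x => g x * q (z * x))) => // x.
  by apply: cvgM; [exact: cg|exact: continuous_compM].
rewrite /spectral_energy; apply: (@cvg_spectral _ _ _ _ ((b - a) * `|g m|)).
- by move=> n; exact: (measurable_trig_sum n.+1 (fun i => h n * g (u n i)) (u n) (@continuous_cos R)).
- by move=> n; exact: (measurable_trig_sum n.+1 (fun i => h n * g (u n i)) (u n) (@continuous_sin R)).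
- by move=> n z; apply: bound; exact: cos_max.
- by move=> n z; apply: bound; exact: sin_max.
- by move=> z; apply: lim; exact: continuous_cos.
- by move=> z; apply: lim; exact: continuous_sin.
Qed.

Lemma cvg_segment_energy (g : R -> R) : mu.-integrable setT (EFin \o g) ->
  spectral_energy `[- n.+1%:R, n.+1%:R] g @[n --> \oo] --> spectral_energy setT g.
Proof.
move=> gi.
pose D n : set R := `[- n.+1%:R, n.+1%:R]%classic.
have mg : measurable_fun setT g by apply/measurable_EFinP; exact: measurable_int gi.
have gD n : mu.-integrable setT (EFin \o (g \_ (D n))).
  have mD : measurable (D n : set (measurableTypeR R)) by exact: measurable_itv.
  rewrite -restrict_EFin; apply/(integrable_mkcond _ mD).
  by apply: (@integrableS _ _ _ mu setT).
(* Truncating [g] puts all the integrals on the same domain, where [|g|] dominates them. *)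
have DE (q : R -> R) n z : \int[mu]_(x in D n) (g x * q (z * x)) =
    \int[mu]_x ((g \_ (D n)) x * q (z * x)).
  rewrite Rintegral_mkcond; apply: eq_Rintegral => x _.
  by rewrite !patchE; case: ifPn; rewrite ?mul0r.
have gDle n x : `|(g \_ (D n)) x| <= `|g x|.
  by rewrite patchE; case: ifPn; rewrite ?normr0.
have mq (q : R -> R) z : continuous q -> measurable_fun setT (fun x : R => q (z * x)).
  by move=> cq; apply: continuous_measurable_fun; exact: continuous_compM.
have bound (q : R -> R) n z : continuous q -> (forall x, `|q x| <= 1) ->
    `|\int[mu]_(x in D n) (g x * q (z * x))| <= \int[mu]_x `|g x|.
  move=> cq q1; rewrite DE.
  have i1 : mu.-integrable setT (EFin \o (fun x => (g \_ (D n)) x * q (z * x))).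
    by apply: (@integrable_mulr_bounded _ _ _ mu _ _ _ _ 1) => //; exact: mq.
  apply: (le_trans (le_normr_Rintegral _ i1)) => //.
  apply: le_Rintegral => //.
  - exact: integrable_norm i1.
  - exact: integrable_norm gi.
  - by move=> x _; rewrite normrM (le_trans _ (gDle n x))// ler_piMr.
have lim (q : R -> R) z : continuous q -> (forall x, `|q x| <= 1) ->
    \int[mu]_(x in D n) (g x * q (z * x)) @[n --> \oo] -->
    \int[mu]_x (g x * q (z * x)).
  move=> cq q1; under eq_fun do rewrite DE.
  apply: (@Rintegral_dominated_cvg _ _ _ mu _ _ _ _ (fun x => `|g x|)) => //.
  - move=> n; apply: measurable_funM; last exact: mq.
    by apply/measurable_EFinP; exact: measurable_int (gD n).
  - move=> x _; apply: cvgM; last exact: cvg_cst.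
    (* A fixed [x] lies in [D n] from some [n] on, after which the truncation has the constant value
       [g x]. *)
    apply: cvg_near_cst; near=> n.
    rewrite patchE mem_set//= /D/= in_itv/= -ler_norml.
    apply: (@le_trans _ _ n%:R); last by rewrite ler_nat.
    by near: n; exact: nbhs_infty_ger.
  - exact: integrable_norm.
  - by move=> n x _; rewrite normrM (le_trans _ (gDle n x))// ler_piMr.
have mF (q : R -> R) n : continuous q -> (forall x, `|q x| <= 1) ->
    measurable_fun setT (fun z : R => \int[mu]_(x in D n) (g x * q (z * x))).
  move=> cq q1; under eq_fun do rewrite DE.
  apply: continuous_measurable_fun; exact: continuous_transform.
have [cc sc] := (@continuous_cos R, @continuous_sin R).
have [c1 s1] := (@cos_max R, @sin_max R).
rewrite /spectral_energy; apply: (@cvg_spectral _ _ _ _ (\int[mu]_x `|g x|)).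
- by move=> n; exact: mF.
- by move=> n; exact: mF.
- by move=> n z; exact: bound.
- by move=> n z; exact: bound.
- by move=> z; exact: lim.
- by move=> z; exact: lim.
Unshelve. all: by end_near. Qed.

End spectral_energy.

(** * Mean squares of complex random variables *)

Section complex_mean_square.
Context {R : realType} {d : measure_display} {Omega : measurableType d}.
Variable P : probability Omega R.
Local Notation mu := (@lebesgue_measure R).

Lemma sqr_cmod (z : R[i]) : cmod z ^+ 2 = complex.Re z ^+ 2 + complex.Im z ^+ 2.
Proof. by case: z => a b; rewrite /= sqr_sqrtr// addr_ge0// sqr_ge0. Qed.

Lemma measurable_sqr_cmod (d' : measure_display) (T : measurableType d') (Z : T -> R[i]) :
  cmeasurable setT Z -> measurable_fun setT (fun w => cmod (Z w) ^+ 2).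
Proof.
move=> [mRe mIm]; under eq_fun do rewrite sqr_cmod.
by apply: measurable_funD; apply: measurable_funX.
Qed.

Lemma cmeasurableB (Z W : Omega -> R[i]) : cmeasurable setT Z ->
  cmeasurable setT W -> cmeasurable setT (fun w => Z w - W w).
Proof.
move=> [mZ1 mZ2] [mW1 mW2].
have eRe w : complex.Re (Z w - W w) = complex.Re (Z w) - complex.Re (W w).
  by case: (Z w) (W w) => ? ? [].
have eIm w : complex.Im (Z w - W w) = complex.Im (Z w) - complex.Im (W w).
  by case: (Z w) (W w) => ? ? [].
split; [under eq_fun do rewrite eRe|under eq_fun do rewrite eIm];
  exact: measurable_funB.
Qed.

Lemma mean_square_ge0 (Z : Omega -> R[i]) : (0 <= mean_square P Z)%E.
Proof. by apply: expectation_ge0 => w; exact: sqr_ge0. Qed.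

Lemma mean_square_triangle (Z S : Omega -> R[i]) : cmeasurable setT Z ->
  cmeasurable setT S ->
  (mean_square P Z <= 2%:E * mean_square P S +
    2%:E * mean_square P (fun w => (S w - Z w)%R))%E.
Proof.
move=> mZ mS; rewrite /mean_square unlock.
have m1 := measurable_sqr_cmod mZ; have m2 := measurable_sqr_cmod mS.
have m3 := measurable_sqr_cmod (cmeasurableB mS mZ).
rewrite -!ge0_integralZl//; try exact/measurable_EFinP;
  try by move=> w _; rewrite lee_fin sqr_ge0.
rewrite -ge0_integralD//; first last.
- by apply: emeasurable_funM => //; exact/measurable_EFinP.
- by move=> w _; rewrite mule_ge0// lee_fin sqr_ge0.
- by apply: emeasurable_funM => //; exact/measurable_EFinP.
- by move=> w _; rewrite mule_ge0// lee_fin sqr_ge0.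
apply: ge0_le_integral => //.
- by move=> w _; rewrite lee_fin sqr_ge0.
- exact/measurable_EFinP.
- by apply: emeasurable_funD; apply: emeasurable_funM => //; exact/measurable_EFinP.
- move=> w _; rewrite -!EFinM -EFinD lee_fin !sqr_cmod.
  case: (Z w) (S w) => a b [a' b'] /=.
  (* In each coordinate [2 s^2 + 2 (s - z)^2 - z^2 = (2 s - z)^2]. *)
  have := sqr_ge0 (2 * a' - a); have := sqr_ge0 (2 * b' - b); nra.
Qed.

(** The factor 2 is the price of [mean_square_triangle], which stands in for Minkowski's
    inequality. *)
Lemma mean_square_limit (Z : Omega -> R[i]) (S : nat -> Omega -> R[i])
    (q : nat -> R) (l : R) :
  cmeasurable setT Z -> (forall n, cmeasurable setT (S n)) ->
  (forall n, (mean_square P (S n) <= (q n)%:E)%E) ->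
  q n @[n --> \oo] --> l ->
  mean_square P (fun w => S n w - Z w) @[n --> \oo] --> 0%E ->
  (mean_square P Z <= (2 * l)%:E)%E.
Proof.
move=> mZ mS Sq ql SZ.
have h : ((2 * q n)%R%:E + 2%:E * mean_square P (fun w => (S n w - Z w)%R))%E
    @[n --> \oo] --> (2 * l)%:E.
  rewrite -[X in _ --> X]adde0 -[X in (_ + X)%E](mule0 2%:E).
  apply: cvgeD => //.
  - by apply: cvg_EFin; [exact: nearW|apply: cvgM => //; exact: cvg_cst].
  - exact: cvgeZl.
rewrite -(cvg_lim _ h)//; apply: lime_ge; first by apply/cvg_ex; exists (2 * l)%:E.
apply: nearW => n; apply: (le_trans (mean_square_triangle mZ (mS n))).
by rewrite EFinM leeD// lee_pmul2l.
Qed.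

End complex_mean_square.

Section uniform_partitions.
Context {R : realType}.

(** The list begins at [a + h], because [tagged_partition] leaves the left endpoint out of it. *)
Definition uniform_partition (a h : R) (n : nat) : seq R :=
  [seq a + i.+1%:R * h | i <- iota 0 n].

Lemma size_uniform_partition a h n : size (uniform_partition a h n) = n.
Proof. by rewrite size_map size_iota. Qed.

Lemma nth_uniform_partition b a h n i : (i < n)%N ->
  nth b (uniform_partition a h n) i = a + i.+1%:R * h.
Proof. by move=> i_n; rewrite (nth_map 0%N) ?size_iota// nth_iota. Qed.

Lemma nth_cons_uniform_partition b a h n i : (i < n)%N ->
  nth b (a :: uniform_partition a h n) i = a + i%:R * h.
Proof.
case: i => [_|i i_n]; first by rewrite mul0r addr0.
by rewrite /= nth_uniform_partition// ltnW.
Qed.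

Lemma uniform_partition_tagged a h n : 0 < h ->
  tagged_partition a (a + n%:R * h) (uniform_partition a h n)
    (fun i => a + i%:R * h).
Proof.
move=> h0; split; last first.
  move=> i; rewrite size_uniform_partition => i_n.
  rewrite nth_cons_uniform_partition// nth_uniform_partition// lexx/=.
  by rewrite lerD2l ler_wpM2r ?(ltW h0)// ler_nat.
rewrite /itv_partition /uniform_partition.
(* Both endpoints are written with an explicit first index 0, which is then generalised: the tail of
   the list starts one index later. *)
have -> : a + n%:R * h = a + (0 + n)%:R * h by rewrite add0n.
have {1 3}-> : a = a + 0%:R * h by rewrite mul0r addr0.
elim: n 0%N => [m|n ih m]; first by rewrite addn0.
have [/= p l] := ih m.+1; split => /=.
  by rewrite p andbT ltrD2l ltr_pM2r// ltr_nat.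
by rewrite -addSnnS.
Qed.

Lemma sum_complex (I : Type) (s : seq I) (F G : I -> R) :
  \sum_(i <- s) (F i +i* G i) = (\sum_(i <- s) F i) +i* (\sum_(i <- s) G i).
Proof.
elim: s => [|i s ih]; first by rewrite !big_nil.
by rewrite !big_cons ih.
Qed.

End uniform_partitions.

(** * Mean square of a coefficient against spectral energy *)

Section coefficient_mean_square.
Context {R : realType} {d : measure_display} {Omega : measurableType d}.
Variable P : probability Omega R.
Local Notation mu := (@lebesgue_measure R).
Variables (X : R -> {RV P >-> R}) (rho : R -> R).
Hypothesis X_stationary : stationary_with_covariance X rho.
Hypothesis X_second : forall t, ('E_P[fun w => (`|X t w| ^+ 2)%R] < +oo)%E.
Hypothesis rho_cont : continuous rho.
Hypothesis rho_int : mu.-integrable setT (EFin \o rho).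
Local Notation r := (cos_transform rho).
Hypothesis r_int : mu.-integrable setT (EFin \o r).
Variable f : R -> R[i].
Hypothesis f_cont : ccontinuous f.
Local Notation fre := (fun x => complex.Re (f x)).
Local Notation fim := (fun x => complex.Im (f x)).
Local Notation Y := (fun t w => (X t w)%:C * (f t)^*%C).

(** Since [X] is real, both parts are real linear combinations of its values, to which the spectral
    bound applies; the minus sign is the conjugation of [f]. *)
Lemma riemann_sum_uniform (a h : R) (n : nat) (w : Omega) :
  riemann_sum Y a (a + n%:R * h) (uniform_partition a h n)
    (fun i => a + i%:R * h) w =
  (\sum_(i < n) (h * fre (a + i%:R * h)) * X (a + i%:R * h) w) +i*
  (\sum_(i < n) (- (h * fim (a + i%:R * h))) * X (a + i%:R * h) w).
Proof.
pose b := a + n%:R * h; pose s := uniform_partition a h n.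
pose F i := (nth b s i - nth b (a :: s) i)%:C *
  ((X (a + i%:R * h) w)%:C * (f (a + i%:R * h))^*%C).
rewrite /riemann_sum -(big_mkord xpredT F) size_uniform_partition.
rewrite -sum_complex -(big_mkord xpredT (fun i =>
  ((h * fre (a + i%:R * h)) * X (a + i%:R * h) w) +i*
  ((- (h * fim (a + i%:R * h))) * X (a + i%:R * h) w))).
apply: eq_big_nat => i /andP[_ i_n]; rewrite /F.
rewrite nth_uniform_partition// nth_cons_uniform_partition//.
have -> : a + i.+1%:R * h - (a + i%:R * h) = h by rewrite -addn1 natrD; ring.
case: (f _) => p q; apply/eqP; rewrite eq_complex /=.
by apply/andP; split; apply/eqP; ring.
Qed.

Lemma integrable_quadratic_form (n : nat) (l t : nat -> R) :
  P.-integrable setT (EFin \o (fun w => (\sum_(i < n) l i * X (t i) w) ^+ 2)).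
Proof.
have -> : (fun w => (\sum_(i < n) l i * X (t i) w) ^+ 2) =
    (fun w => \sum_(i < n) \sum_(j < n) (l i * l j) * (X (t i) w * X (t j) w)).
  apply/funext => w; rewrite expr2 big_distrlr/=.
  by apply: eq_bigr => i _; apply: eq_bigr => j _; ring.
apply: integrable_Rsum => // i; apply: integrable_Rsum => // j.
by apply: integrable_scale => //; exact: integrable_product.
Qed.

Lemma mean_square_quadratic (n : nat) (l m t : nat -> R) :
  mean_square P (fun w => (\sum_(i < n) l i * X (t i) w) +i*
                          (\sum_(i < n) m i * X (t i) w)) =
  (\int[P]_w ((\sum_(i < n) l i * X (t i) w) ^+ 2) +
   \int[P]_w ((\sum_(i < n) m i * X (t i) w) ^+ 2))%:E.
Proof.
have li := integrable_quadratic_form n l t.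
have mi := integrable_quadratic_form n m t.
rewrite /mean_square unlock -RintegralD// /Rintegral fineK; last first.
  by apply: integrable_fin_num => //; exact: integrable_add.
by apply: eq_integral => w _; rewrite sqr_cmod.
Qed.

Lemma cmeasurable_sum (n : nat) (l m t : nat -> R) :
  cmeasurable setT (fun w => (\sum_(i < n) l i * X (t i) w) +i*
                             (\sum_(i < n) m i * X (t i) w)).
Proof.
split => /=; apply: measurable_sum => i; apply: measurable_funM => //;
  exact: measurable_cst.
Qed.

Lemma ge0_cvge0 (u : nat -> \bar R) : (forall n, 0 <= u n)%E ->
  (forall e : R, 0 < e -> \forall n \near \oo, (u n < e%:E)%E) ->
  u n @[n --> \oo] --> 0%E.
Proof.
move=> u0 ue; apply/fine_cvgP; split.
  apply: filterS (ue 1 ltr01) => n un.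
  by rewrite ge0_fin_numE// (lt_trans un)// ltry.
apply/cvgrPdist_lt => e e0; apply: filterS (ue e e0) => n un.
rewrite sub0r normrN ger0_norm ?fine_ge0//= -lte_fin fineK//.
by rewrite ge0_fin_numE// (lt_trans un)// ltry.
Qed.

(** A mean-square integral is the limit along all fine tagged partitions, in particular along the
    uniform ones tagged at left endpoints, whose energies converge. *)
Lemma ms_integral_le (a b : R) (J : Omega -> R[i]) : a < b ->
  is_ms_integral P Y a b J ->
  (mean_square P J <= (2 * (spectral_energy r `[a, b] fre +
                            spectral_energy r `[a, b] fim))%:E)%E.
Proof.
move=> ab [mJ Jlim]; have [cre cim] := f_cont.
pose h n := (b - a) / n.+1%:R; pose u n i := a + i%:R * h n.
have h0 n : 0 < h n by rewrite divr_gt0 ?subr_gt0.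
have bE n : b = a + n.+1%:R * h n.
  have N0 : n.+1%:R != 0 :> R by rewrite pnatr_eq0.
  by rewrite /h mulrCA divff// mulr1 addrC subrK.
pose energy g n := fejer_mass^-1 * \int[mu]_(z in `[0, +oo[) (`|r z| *
    ((\sum_(i < n.+1) h n * g (u n i) * cos (z * u n i)) ^+ 2 +
     (\sum_(i < n.+1) h n * g (u n i) * sin (z * u n i)) ^+ 2)).
pose S n := riemann_sum Y a b (uniform_partition a (h n) n.+1) (u n).
have SE n : S n = fun w =>
    (\sum_(i < n.+1) (h n * fre (u n i)) * X (u n i) w) +i*
    (\sum_(i < n.+1) (- (h n * fim (u n i))) * X (u n i) w).
  by apply/funext => w; rewrite /S [in X in riemann_sum _ _ X](bE n) riemann_sum_uniform.
apply: (@mean_square_limit _ _ _ P J S (fun n => energy fre n + energy fim n)) => //.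
- by move=> n; rewrite SE; exact: (cmeasurable_sum n.+1
    (fun i => h n * fre (u n i)) (fun i => - (h n * fim (u n i))) (u n)).
- move=> n; rewrite SE.
  rewrite (mean_square_quadratic n.+1 (fun i => h n * fre (u n i))
    (fun i => - (h n * fim (u n i))) (u n)) lee_fin; apply: lerD.
    exact: (quadratic_form_le X_stationary X_second rho_cont rho_int r_int n.+1
      (fun i => h n * fre (u n i)) (u n)).
  (* The sign brought by the conjugation disappears in the square. *)
  under eq_Rintegral do under eq_bigr do rewrite mulNr.
  under eq_Rintegral do rewrite sumrN sqrrN.
  exact: (quadratic_form_le X_stationary X_second rho_cont rho_int r_int n.+1
      (fun i => h n * fim (u n i)) (u n)).
- by apply: cvgD; exact: cvg_riemann_energy.
- apply: ge0_cvge0 => [n|e e0]; first exact: mean_square_ge0.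
  have [dl dl0 Jdl] := Jlim e e0.
  have hdl : \forall n \near \oo, h n < dl.
    have : h n @[n --> \oo] --> (0 : R).
      by rewrite -(mulr0 (b - a)); apply: cvgM; [exact: cvg_cst|exact: cvg_harmonic].
    move/cvgrPdist_lt => /(_ _ dl0); apply: filterS => n.
    by rewrite sub0r normrN gtr0_norm.
  apply: filterS hdl => n hn; apply: Jdl.
    by rewrite [X in tagged_partition _ X](bE n); exact: uniform_partition_tagged.
  move=> i; rewrite size_uniform_partition => i_n.
  rewrite nth_uniform_partition// nth_cons_uniform_partition//.
  by rewrite -addn1 natrD opprD addrACA subrr add0r mulrDl mul1r addrAC subrr add0r.
Qed.

Hypothesis fre_int : mu.-integrable setT (EFin \o fre).
Hypothesis fim_int : mu.-integrable setT (EFin \o fim).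

(** The 4 is a factor 2 for the Riemann sums times a factor 2 for the growing segments. Symmetric
    segments are one admissible way for both endpoints to go to infinity; [n.+1] keeps them
    nondegenerate at [n = 0]. *)
Lemma coefficient_le_energy (Z : Omega -> R[i]) : is_coefficient X f Z ->
  (mean_square P Z <= (4 * (spectral_energy r setT fre +
                            spectral_energy r setT fim))%:E)%E.
Proof.
move=> [mZ [J [Jint JZ]]].
pose a (n : nat) : R := - n.+1%:R; pose b (n : nat) : R := n.+1%:R.
have ab n : a n < b n by rewrite /a /b; have : 0 < n.+1%:R :> R by []; lra.
have -> : 4 * (spectral_energy r setT fre + spectral_energy r setT fim) =
    2 * (2 * (spectral_energy r setT fre + spectral_energy r setT fim)) by ring.
apply: (@mean_square_limit _ _ _ P Z (fun n => J (a n) (b n))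
  (fun n => 2 * (spectral_energy r `[a n, b n] fre + spectral_energy r `[a n, b n] fim))) => //.
- by move=> n; have [] := Jint _ _ (ab n).
- by move=> n; exact: ms_integral_le (ab n) (Jint _ _ (ab n)).
- apply: cvgM; first exact: cvg_cst.
  by apply: cvgD; apply: cvg_segment_energy.
- have aby : (a n, b n) @[n --> \oo] --> filter_prod (ninfty_nbhs R) (pinfty_nbhs R).
    have ay : a n @[n --> \oo] --> -oo.
      apply/cvgrNyPle => A; near=> n; rewrite /a lerNl.
      apply: (@le_trans _ _ n%:R); last by rewrite ler_nat.
      by near: n; exact: nbhs_infty_ger.
    have by_ : b n @[n --> \oo] --> +oo.
      apply/cvgryPge => A; near=> n; rewrite /b.
      apply: (@le_trans _ _ n%:R); last by rewrite ler_nat.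
      by near: n; exact: nbhs_infty_ger.
    exact: (cvg_pair ay by_).
  exact: (cvg_comp _ _ aby JZ).
Unshelve. all: by end_near. Qed.

End coefficient_mean_square.

(** * Fourier transforms of wavelets *)

Section fourier_transform.
Context {R : realType}.
Local Notation mu := (@lebesgue_measure R).

Lemma ReRM (x : R) (z : R[i]) : complex.Re (x%:C * z) = x * complex.Re z.
Proof. by case: z => p q /=; rewrite mul0r subr0. Qed.

Lemma ImRM (x : R) (z : R[i]) : complex.Im (x%:C * z) = x * complex.Im z.
Proof. by case: z => p q /=; rewrite mul0r addr0. Qed.

Lemma integrable_trig (g q : R -> R) (z : R) : mu.-integrable setT (EFin \o g) ->
  continuous q -> (forall x, `|q x| <= 1) ->
  mu.-integrable setT (EFin \o (fun x => g x * q (z * x))).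
Proof.
move=> gi cq q1.
apply: (@integrable_mulr_bounded _ _ _ mu _ measurableT _ _ 1) => //.
by apply: continuous_measurable_fun; exact: continuous_compM.
Qed.

Section fourier_of_integrable.
Variable f : R -> R[i].
Hypothesis f_int : cintegrable f.
Local Notation fre := (fun x => complex.Re (f x)).
Local Notation fim := (fun x => complex.Im (f x)).
Local Notation coef g q z := (\int[mu]_x (g x * q (z * x))).

Lemma fourierE (z : R) : fourier f z =
  (coef fre cos z + coef fim sin z) +i* (coef fim cos z - coef fre sin z).
Proof.
have [rei imi] := f_int.
have [cc sc] := (@continuous_cos R, @continuous_sin R).
have [c1 s1] := (@cos_max R, @sin_max R).
rewrite /fourier /cintegral; congr (_ +i* _).
  rewrite -RintegralD//; try exact: integrable_trig.
  apply: eq_Rintegral => x _; case: (f x) => p q.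
  by rewrite /= cosN sinN; ring.
rewrite -RintegralB//; try exact: integrable_trig.
apply: eq_Rintegral => x _; case: (f x) => p q.
by rewrite /= cosN sinN; ring.
Qed.

(* The cross terms of [|f^(z)|^2] and [|f^(-z)|^2] cancel only in their sum,
   hence the even majorants [H] below. *)
Lemma fourier_parallelogram (z : R) :
  cmod (fourier f z) ^+ 2 + cmod (fourier f (- z)) ^+ 2 =
  2 * ((coef fre cos z ^+ 2 + coef fre sin z ^+ 2) +
       (coef fim cos z ^+ 2 + coef fim sin z ^+ 2)).
Proof.
have cE g : coef g cos (- z) = coef g cos z.
  by apply: eq_Rintegral => x _; rewrite mulNr cosN.
have sE g : mu.-integrable setT (EFin \o g) -> coef g sin (- z) = - coef g sin z.
  move=> gi; rewrite -[RHS]mulN1r -RintegralZl//; last first.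
    exact: integrable_trig (@continuous_sin R) (@sin_max R).
  by apply: eq_Rintegral => x _; rewrite mulNr sinN; ring.
have [rei imi] := f_int.
by rewrite !fourierE !sqr_cmod/= !cE !sE//; ring.
Qed.

Lemma ccontinuous_fourier : ccontinuous (fourier f).
Proof.
have [rei imi] := f_int; have cf g q := @continuous_transform R g q.
have [cc sc] := (@continuous_cos R, @continuous_sin R).
have [c1 s1] := (@cos_max R, @sin_max R).
split; under eq_fun do rewrite fourierE/=; move=> z.
  by apply: cvgD; exact: cf.
by apply: cvgB; exact: cf.
Qed.

(** Real and imaginary part are each at most the sum of the two L1 norms, hence the 2. This is the
    constant majorant used for the [xi_0k]. *)
Lemma cmod_fourier_le (z : R) : cmod (fourier f z) ^+ 2 <=
  2 * ((\int[mu]_x `|fre x|) + (\int[mu]_x `|fim x|)) ^+ 2.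
Proof.
have [rei imi] := f_int.
have [cc sc] := (@continuous_cos R, @continuous_sin R).
have [c1 s1] := (@cos_max R, @sin_max R).
have le g q : mu.-integrable setT (EFin \o g) -> continuous q ->
    (forall x, `|q x| <= 1) -> `|coef g q z| <= \int[mu]_x `|g x|.
  move=> gi cq q1; have i1 := integrable_trig z gi cq q1.
  apply: (le_trans (le_normr_Rintegral measurableT i1)).
  apply: le_Rintegral => //; [exact: integrable_norm i1|exact: integrable_norm gi|].
  by move=> x _; rewrite normrM ler_piMr.
rewrite fourierE sqr_cmod/= mulr_natl mulr2n.
have sq (x K : R) : `|x| <= K -> x ^+ 2 <= K ^+ 2.
  move=> xK; rewrite -real_normK ?num_real// lerXn2r ?nnegrE//.
  exact: le_trans xK.
apply: lerD; apply: sq.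
  by apply: (le_trans (ler_normD _ _)); apply: lerD; exact: le.
by rewrite [leRHS]addrC; apply: (le_trans (ler_normB _ _)); apply: lerD; exact: le.
Qed.

(** By [fourier_parallelogram], twice the sum of the two trigonometric factors is at most
    [H z + H (- z) = 2 H z]. *)
Lemma spectral_energy_le (r H : R -> R) :
  (forall z, cmod (fourier f z) ^+ 2 <= H z) -> (forall z, H (- z) = H z) ->
  mu.-integrable setT (EFin \o r) ->
  mu.-integrable `[0, +oo[ (EFin \o (fun z => `|r z| * H z)) ->
  spectral_energy r setT fre + spectral_energy r setT fim <=
  fejer_mass^-1 * \int[mu]_(z in `[0, +oo[) (`|r z| * H z).
Proof.
move=> fH Heven ri rH; have [rei imi] := f_int.
pose q g z := coef g cos z ^+ 2 + coef g sin z ^+ 2.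
have q0 g z : 0 <= q g z by rewrite addr_ge0 ?sqr_ge0.
have qH z : q fre z + q fim z <= H z.
  have := fourier_parallelogram z; have := fH z; have := fH (- z).
  by rewrite Heven -/(q fre z) -/(q fim z); lra.
have ri0 : mu.-integrable `[0, +oo[ (EFin \o r).
  by apply: (@integrableS _ _ _ mu setT).
have mq g : mu.-integrable setT (EFin \o g) ->
    measurable_fun (`[0, +oo[%classic : set R) (fun z => `|r z| * q g z).
  move=> gi; apply: measurable_funM.
    by apply/measurable_EFinP; exact: measurable_int (integrable_norm ri0).
  apply: measurable_funTS; apply: measurable_funD; apply: measurable_funX;
    apply: continuous_measurable_fun; apply: continuous_transform => //.
  - exact: continuous_cos.
  - exact: cos_max.
  - exact: continuous_sin.
  - exact: sin_max.
have iq g : mu.-integrable setT (EFin \o g) -> (forall z, q g z <= H z) ->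
    mu.-integrable `[0, +oo[ (EFin \o (fun z => `|r z| * q g z)).
  move=> gi gH; apply: (@integrable_of_le _ _ _ mu _ _ _ _ _ rH) => //.
    exact: mq.
  by move=> z _; rewrite normrM normr_id ler_wpM2l// ger0_norm.
have i1 : mu.-integrable `[0, +oo[ (EFin \o (fun z => `|r z| * q fre z)).
  by apply: iq => // z; apply: le_trans (qH z); rewrite lerDl.
have i2 : mu.-integrable `[0, +oo[ (EFin \o (fun z => `|r z| * q fim z)).
  by apply: iq => // z; apply: le_trans (qH z); rewrite lerDr.
rewrite /spectral_energy -mulrDr ler_wpM2l ?invr_ge0 ?(ltW (fejer_mass_gt0))//.
rewrite -RintegralD//; apply: le_Rintegral => //.
  exact: integrable_add.
by move=> z _; rewrite -mulrDr ler_wpM2l//; exact: qH.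
Qed.

End fourier_of_integrable.

Lemma cintegrable_dilate (f : R -> R[i]) j k : cintegrable f ->
  cintegrable (dilate_translate f j k).
Proof.
move=> [rei imi]; have a0 : 0 < 2 ^+ j :> R by rewrite exprn_gt0.
have h (g : R -> R) : mu.-integrable setT (EFin \o g) -> mu.-integrable setT
    (EFin \o (fun x => 2 `^ (j%:R / 2) * g (2 ^+ j * x - k%:~R))).
  by move=> gi; apply: integrable_scale => //; exact: (integrable_affine (- k%:~R) a0 gi).
rewrite /cintegrable; split.
- have -> : (fun x => (complex.Re (dilate_translate f j k x))%:E) =
      EFin \o (fun x => 2 `^ (j%:R / 2) * complex.Re (f (2 ^+ j * x - k%:~R))).
    by apply/funext => x /=; rewrite ReRM.
  exact: h rei.
- have -> : (fun x => (complex.Im (dilate_translate f j k x))%:E) =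
      EFin \o (fun x => 2 `^ (j%:R / 2) * complex.Im (f (2 ^+ j * x - k%:~R))).
    by apply/funext => x /=; rewrite ImRM.
  exact: h imi.
Qed.

Lemma ccontinuous_dilate (f : R -> R[i]) j k : ccontinuous f ->
  ccontinuous (dilate_translate f j k).
Proof.
move=> [cre cim].
have h (g : R -> R) : continuous g ->
    continuous (fun x : R => 2 `^ (j%:R / 2) * g (2 ^+ j * x - k%:~R)).
  move=> cg x; apply: cvgM; first exact: cvg_cst.
  apply: (@continuous_comp _ _ _ (fun x : R => 2 ^+ j * x - k%:~R) g); last exact: cg.
  by apply: cvgB; [apply: cvgM; [exact: cvg_cst|exact: cvg_id]|exact: cvg_cst].
split.
- by under eq_fun do rewrite ReRM; exact: (h (fun x => complex.Re (f x))).
- by under eq_fun do rewrite ImRM; exact: (h (fun x => complex.Im (f x))).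
Qed.

(** With [a = 2^j] and [c = 2^(j/2)], the substitution leaves the amplitude [c / a = 1 / c], while
    the translation by [k] adds the phase [th]. In coordinates this phase is a rotation of the
    cosine and sine integrals, which the modulus does not see. *)
Lemma cmod_fourier_dilate (f : R -> R[i]) j k (z : R) : cintegrable f ->
  cmod (fourier (dilate_translate f j k) z) ^+ 2 =
  2 ^- j * cmod (fourier f (z / 2 ^+ j)) ^+ 2.
Proof.
move=> fi; have [rei imi] := fi.
have [cc sc] := (@continuous_cos R, @continuous_sin R).
have [c1 s1] := (@cos_max R, @sin_max R).
set a : R := 2 ^+ j; have a0 : 0 < a by rewrite exprn_gt0.
have an0 : a != 0 by rewrite gt_eqF.
pose c : R := 2 `^ (j%:R / 2).
have c2 : c ^+ 2 = a.
  rewrite /c -powR_mulrn ?powR_ge0// -powRrM.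
  by rewrite -mulrA mulVf// mulr1 powR_mulrn.
pose b : R := k%:~R; pose zeta := z / a; pose th := zeta * b.
pose cf (g q : R -> R) := \int[mu]_x (g x * q (zeta * x)).
have it (g q : R -> R) : mu.-integrable setT (EFin \o g) -> continuous q ->
    (forall x, `|q x| <= 1) -> mu.-integrable setT (EFin \o (fun x => g x * q (zeta * x))).
  exact: integrable_trig.
have angle x : z * x = zeta * (a * x - b) + th by rewrite /th /zeta; field.
have dil (h : R -> R) : mu.-integrable setT (EFin \o h) ->
    \int[mu]_x (c * h (a * x - b)) = c / a * \int[mu]_x h x.
  move=> hi; rewrite (Rintegral_affine (- b) a0 hi) mulrA divfK// RintegralZl//.
  exact: (integrable_affine (- b) a0 hi).
have Cc (g : R -> R) : mu.-integrable setT (EFin \o g) ->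
    \int[mu]_x (c * g (a * x - b) * cos (z * x)) =
    c / a * (cos th * cf g cos - sin th * cf g sin).
  move=> gi; have ic := it g cos gi cc c1; have is_ := it g sin gi sc s1.
  have ki := integrable_add measurableT (integrable_scale measurableT (cos th) ic)
    (integrable_scale measurableT (- sin th) is_).
  have -> : cos th * cf g cos - sin th * cf g sin = \int[mu]_x
      (cos th * (g x * cos (zeta * x)) + - sin th * (g x * sin (zeta * x))).
    by rewrite RintegralD ?RintegralZl// ?mulNr//; exact: integrable_scale.
  rewrite -(dil _ ki); apply: eq_Rintegral => x _.
  by rewrite angle cosD; ring.
have Cs (g : R -> R) : mu.-integrable setT (EFin \o g) ->
    \int[mu]_x (c * g (a * x - b) * sin (z * x)) =
    c / a * (cos th * cf g sin + sin th * cf g cos).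
  move=> gi; have ic := it g cos gi cc c1; have is_ := it g sin gi sc s1.
  have ki := integrable_add measurableT (integrable_scale measurableT (cos th) is_)
    (integrable_scale measurableT (sin th) ic).
  have -> : cos th * cf g sin + sin th * cf g cos = \int[mu]_x
      (cos th * (g x * sin (zeta * x)) + sin th * (g x * cos (zeta * x))).
    by rewrite RintegralD ?RintegralZl//; exact: integrable_scale.
  rewrite -(dil _ ki); apply: eq_Rintegral => x _.
  by rewrite angle sinD; ring.
rewrite fourierE; last exact: cintegrable_dilate.
rewrite (fourierE fi) !sqr_cmod/=.
have reE q : \int[mu]_x (complex.Re (dilate_translate f j k x) * q (z * x)) =
    \int[mu]_x (c * complex.Re (f (a * x - b)) * q (z * x)).
  by apply: eq_Rintegral => x _; rewrite ReRM.
have imE q : \int[mu]_x (complex.Im (dilate_translate f j k x) * q (z * x)) =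
    \int[mu]_x (c * complex.Im (f (a * x - b)) * q (z * x)).
  by apply: eq_Rintegral => x _; rewrite ImRM.
rewrite !reE !imE !(Cc _ rei) !(Cc _ imi) !(Cs _ rei) !(Cs _ imi).
rewrite -!/(cf _ _) -c2.
set x1 := cf _ cos; set x2 := cf _ cos; set y1 := cf _ sin; set y2 := cf _ sin.
have c0 : c != 0 by rewrite gt_eqF// powR_gt0.
transitivity (c ^- 2 * (cos th ^+ 2 + sin th ^+ 2) *
  ((x1 + y2) ^+ 2 + (x2 - y1) ^+ 2)).
  by field.
by rewrite cos2Dsin2 mulr1.
Qed.

End fourier_transform.

(** * Quadrature mirror identity and vanishing of the wavelet transform at 0 *)

Section quadrature_mirror.
Context {R : realType}.
Local Notation mu := (@lebesgue_measure R).

Lemma esum_pZl (T : choiceType) (c : R) (A : set T) (a : T -> \bar R) :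
  0 <= c -> (forall i, (0 <= a i)%E) ->
  (\esum_(i in A) (c%:E * a i) = c%:E * \esum_(i in A) a i)%E.
Proof.
move=> c0 a0; rewrite /esum -ereal_supZl//; last first.
  apply/set0P; exists (\sum_(x \in set0) a x)%E; exists set0 => //.
  exact: fsets_set0.
congr ereal_sup; rewrite image_comp; apply: eq_imagel => /= X _.
by rewrite -ge0_mule_fsumr.
Qed.

Lemma periodic_int (f : R -> R[i]) (T : R) : periodic f T ->
  forall (k : int) u, f (u + T * k%:~R) = f u.
Proof.
move=> fT [n|n] u.
  by rewrite -[(Posz n)%:~R]/(n%:R) mulr_natr periodicn.
rewrite NegzE mulrNz mulrN -[(Posz n.+1)%:~R]/(n.+1%:R) mulr_natr.
by rewrite -(periodicn fT n.+1 (u - T *+ n.+1)) subrK.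
Qed.

(** Halving [y + 2 pi k] gives [y / 2 + 2 pi l] for [k = 2 l] and [y / 2 + pi + 2 pi l] for
    [k = 2 l + 1]: two orthonormality sums. *)
Lemma esum_int_parity (a : int -> \bar R) : (forall k, (0 <= a k)%E) ->
  (\esum_(k in [set: int]) a k =
   \esum_(l in [set: int]) a (2 * l)%R + \esum_(l in [set: int]) a (2 * l + 1)%R)%E.
Proof.
move=> a0; pose e0 (l : int) := 2 * l; pose e1 (l : int) := 2 * l + 1.
rewrite (esumID (range e0))// setTI.
have -> : [set: int] `&` ~` range e0 = range e1.
  rewrite setTI; apply/seteqP; split => k /=.
    move=> ke0; exists (k %/ 2)%Z => //; rewrite /e1.
    have kE := divz_eq k 2; have [|k1] := eqVneq (k %% 2)%Z 0.
      by move=> k0; case: ke0; exists (k %/ 2)%Z => //; rewrite /e0; lia.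
    have := modz_ge0 k (isT : (2 : int) != 0).
    have := ltz_pmod k (isT : 0 < (2 : int)); lia.
  by move=> [l _ <-] [l' _]; rewrite /e0 /e1; lia.
rewrite !esum_image// => x y _ _; rewrite /e0 /e1; lia.
Qed.

(** Here [F] stands for [|phi^|^2] and [M] for [|m0|^2]. On each parity class [M] is constant by
    periodicity and factors out of the sum at [y]; what remains is the sum at [y / 2] or at
    [y / 2 + pi], equal to 1. *)
Lemma qmf_pointwise (F : R -> R) (M : R -> R) (y : R) :
  (forall x, 0 <= F x) -> (forall x, 0 <= M x) ->
  (forall (k : int) u, M (u + (pi *+ 2) * k%:~R) = M u) ->
  (forall k : int, F (y + (pi *+ 2) * k%:~R) =
     M ((y + (pi *+ 2) * k%:~R) / 2) * F ((y + (pi *+ 2) * k%:~R) / 2)) ->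
  (\esum_(k in [set: int]) (F (y + (pi *+ 2) * k%:~R))%:E = 1)%E ->
  (\esum_(k in [set: int]) (F (y / 2 + (pi *+ 2) * k%:~R))%:E = 1)%E ->
  (\esum_(k in [set: int]) (F (y / 2 + pi + (pi *+ 2) * k%:~R))%:E = 1)%E ->
  M (y / 2) + M (y / 2 + pi) = 1.
Proof.
move=> F0 M0 Mper Fref s1 s2 s3.
apply: EFin_inj; rewrite EFinD -[RHS]s1 esum_int_parity; last first.
  by move=> k; rewrite lee_fin.
congr (_ + _)%E.
- transitivity (\esum_(l in [set: int])
      ((M (y / 2))%:E * (F (y / 2 + pi *+ 2 * l%:~R))%:E))%E.
    by rewrite esum_pZl ?s2 ?mule1// => l; rewrite lee_fin.
  apply: eq_esum => l _.
  rewrite -EFinM Fref.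
  have -> : (y + pi *+ 2 * (2 * l)%:~R) / 2 = y / 2 + pi *+ 2 * l%:~R.
    by rewrite intrM -[2%:~R]/(2 : R); field.
  by rewrite Mper.
- transitivity (\esum_(l in [set: int])
      ((M (y / 2 + pi))%:E * (F (y / 2 + pi + pi *+ 2 * l%:~R))%:E))%E.
    by rewrite esum_pZl ?s3 ?mule1// => l; rewrite lee_fin.
  apply: eq_esum => l _.
  rewrite -EFinM Fref.
  have -> : (y + pi *+ 2 * (2 * l + 1)%:~R) / 2 = y / 2 + pi + pi *+ 2 * l%:~R.
    by rewrite intrD intrM -[2%:~R]/(2 : R) -[1%:~R]/(1 : R) mulr2n; field.
  by rewrite Mper.
Qed.

(** Otherwise [D] is nonzero on a ball around [x], and a null set would contain that ball. *)
Lemma ae_eq0_at (D : R -> R) (x : R) : {for x, continuous D} ->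
  {ae mu, forall y, D y = 0} -> D x = 0.
Proof.
move=> cD [N [mN N0 DN]]; apply: contrapT => /eqP Dx.
have D0 : 0 < `|D x| by rewrite normr_gt0.
have /cvgrPdist_lt/(_ _ D0)/nbhs_ballP[e /= e0 eD] := cD.
have : (mu (ball x e) <= mu N)%E.
  apply: le_measure; rewrite ?inE//; first exact: measurable_ball.
  move=> y xy; apply: DN => /= Dy; have := eD y xy; rewrite Dy subr0; lra.
rewrite lebesgue_measure_ball ?(ltW e0)// N0 lee_fin; lra.
Qed.

Lemma ae_forall_int (Q : int -> R -> Prop) : (forall k, {ae mu, forall y, Q k y}) ->
  {ae mu, forall y, forall k, Q k y}.
Proof.
move=> aQ.
have : mu.-negligible (\bigcup_n (~` [set y | Q (Posz n) y] `|` ~` [set y | Q (Negz n) y])).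
  by apply: negligible_bigcup => n; apply: negligibleU; exact: aQ.
apply: negligibleS => y /= /existsNP[[n|n] nQ]; exists n => //; [left|right]; exact: nQ.
Qed.

Lemma continuous_at_sum_sqr (g h : R -> R) (x : R) : {for x, continuous g} ->
  {for x, continuous h} -> {for x, continuous (fun y => g y ^+ 2 + h y ^+ 2)}.
Proof.
move=> cg ch; apply: cvgD.
- exact: (cvg_comp _ _ cg (@exprn_continuous R 2 (g x))).
- exact: (cvg_comp _ _ ch (@exprn_continuous R 2 (h x))).
Qed.

(* No lower bound on [phi^] near 0 is needed: the identity turns the factor
   [|m0(y/2 + pi)|^2] into a difference of values of [|phi^|^2]. *)
Lemma m_wavelet_fourier_ae (phi psi : R -> R[i]) :
  f_wavelet phi -> m_wavelet phi psi ->
  {ae mu, forall y, cmod (fourier phi y) ^+ 2 + cmod (fourier psi y) ^+ 2 =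
                    cmod (fourier phi (y / 2)) ^+ 2}.
Proof.
move=> [_ [_ _ osum _]] [m0 [m0per _ ref] [_ psiE]].
pose F y := cmod (fourier phi y) ^+ 2; pose M y := cmod (m0 y) ^+ 2.
(* The orthonormality sum is used at [y], [y / 2] and [y / 2 + pi], and the refinement equation at
   every [y + 2 pi k]. *)
have pos2 : 0 < 2^-1 :> R by rewrite invr_gt0.
have s2 := ae_affine 0 pos2 osum.
have s3 := ae_affine pi pos2 osum.
have refk := ae_forall_int (fun k => ae_affine (pi *+ 2 * k%:~R) ltr01 ref).
have Fil := ae_filter_ringOfSetsType mu.
have h1 := @filterI _ _ Fil _ _ osum s2; have h2 := @filterI _ _ Fil _ _ s3 refk.
apply: (@filterS3 _ _ Fil _ _ _ _ _ h1 h2 psiE) => y [s1 {}s2] [{}s3 rk] psiy.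
have rkF (k : int) : F (y + pi *+ 2 * k%:~R) =
    M ((y + pi *+ 2 * k%:~R) / 2) * F ((y + pi *+ 2 * k%:~R) / 2).
  by rewrite /F /M -exprMn -Normc.normcM -{1}[y]mul1r rk mul1r.
have Mper (k : int) u : M (u + pi *+ 2 * k%:~R) = M u.
  by rewrite /M periodic_int.
have F0 x : 0 <= F x by exact: sqr_ge0.
have M0 x : 0 <= M x by exact: sqr_ge0.
rewrite addr0 [_ * y]mulrC in s2; rewrite [_ * y]mulrC in s3.
have MM := qmf_pointwise F0 M0 Mper rkF s1 s2 s3.
have cisE (t : R) : cmod (cis t) = 1 by rewrite /= cos2Dsin2 sqrtr1.
have conjE (u : R[i]) : cmod u^*%C = cmod u.
  by case: u => p q /=; rewrite sqrrN.
have := rkF 0; rewrite mulr0 addr0 => Fy.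
rewrite psiy -/(F y) -/(F (y / 2)) Fy !Normc.normcM cisE conjE mulr1 exprMn.
by rewrite -/(M _) -/(F _) -mulrDl MM mul1r.
Qed.

(** All three terms of the almost-everywhere identity are continuous at 0, the ones in [phi^] by
    definition of an f-wavelet and [psi^] because [psi] is integrable. So the identity holds at 0
    itself, where both terms in [phi^] coincide. *)
Lemma m_wavelet_fourier0 (phi psi : R -> R[i]) :
  f_wavelet phi -> m_wavelet phi psi -> cintegrable psi -> fourier psi 0 = 0.
Proof.
move=> fw mw psi_int; have ae := m_wavelet_fourier_ae fw mw.
have [_ [_ [cre cim] _ _]] := fw.
have [dre dim] := ccontinuous_fourier psi_int.
pose Q (f : R -> R[i]) y := complex.Re (fourier f y) ^+ 2 + complex.Im (fourier f y) ^+ 2.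
have cF : {for (0 : R), continuous (Q phi)} by exact: continuous_at_sum_sqr cre cim.
have cV : {for (0 : R), continuous (Q psi)} by exact: continuous_at_sum_sqr (dre 0) (dim 0).
have half : (y : R) / 2 @[y --> (0 : R)] --> (0 : R).
  by rewrite -[X in _ --> X](mul0r 2^-1); apply: cvgM; [exact: cvg_id|exact: cvg_cst].
have cF2 : {for (0 : R), continuous (fun y : R => Q phi (y / 2))}.
  have := cvg_comp _ _ half cF; rewrite -[X in Q phi X](mul0r (2^-1 : R)); exact.
have : Q phi 0 + Q psi 0 - Q phi (0 / 2) = 0.
  apply: (@ae_eq0_at (fun y => Q phi y + Q psi y - Q phi (y / 2))).
    by apply: cvgB; [apply: cvgD; [exact: cF|exact: cV]|exact: cF2].
  apply: (@filterS _ _ (ae_filter_ringOfSetsType mu) _ _ _ ae) => y.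
  by rewrite !sqr_cmod -!/(Q _ _) => ->; rewrite subrr.
rewrite mul0r addrAC subrr add0r /Q -sqr_cmod => /eqP.
by rewrite sqrf_eq0 => /eqP; exact: Normc.eq0_normc.
Qed.

End quadrature_mirror.

(** * The theorem *)

Section radial_majorant.
Context {R : realType}.
Local Notation mu := (@lebesgue_measure R).
Variables (Phi : R -> R) (f : R -> R[i]).
Hypothesis f_S : assumption_S Phi f.

Lemma majorant_ge0 (x : R) : 0 <= Phi `|x|.
Proof. by have [P0 _ _ _] := f_S; apply: P0; rewrite in_itv/= andbT. Qed.

(** Superlevel sets are intervals: a point [u] between [s] and [t] has [|u|] at most [|s|] or [|t|],
    and [Phi] is decreasing. *)
Lemma measurable_majorant : measurable_fun setT (fun x : R => Phi `|x|).
Proof.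
have [_ Pd _ _] := f_S.
apply: (measurability (@RGenCInfty.G R)) => [|/= _ [_] [r] -> <-].
  exact: RGenCInfty.measurableE.
apply: measurableI => //; apply: is_interval_measurable => s t/=.
rewrite !in_itv/= !andbT => rs rt u /andP[su ut].
rewrite in_itv/= andbT.
have [us|us] := leP `|u| `|s|.
  by apply: (le_trans rs); apply: Pd; rewrite ?in_itv/= ?andbT.
apply: (le_trans rt); apply: Pd; rewrite ?in_itv/= ?andbT//.
have := ler_norm t; have := ler_norm (- s); rewrite normrN.
by move: us; case: (ler0P u) => u0; lra.
Qed.

Lemma integrable_majorant : mu.-integrable setT (EFin \o (fun x : R => Phi `|x|)).
Proof.
have [_ _ _ Pi] := f_S; apply: integrable_finite_integral => //.
  exact: measurable_majorant.
move: Pi; congr (_ < _)%E; apply: eq_integral => x _.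
by rewrite (ger0_norm (majorant_ge0 x)).
Qed.

Lemma C_S_ge0 : (0 <= C_S Phi)%E.
Proof.
have [P0 _ _ _] := f_S; rewrite adde_ge0//.
  by rewrite mule_ge0// lee_fin P0// in_itv/= lexx.
rewrite mule_ge0//; apply: integral_ge0 => x /=; rewrite in_itv/= andbT => x0.
by rewrite lee_fin P0// in_itv/= andbT; lra.
Qed.

Lemma C_S_lty : (C_S Phi < +oo)%E.
Proof.
have [_ _ _ Pi] := f_S; rewrite /C_S lte_add_pinfty//; first by rewrite -EFinM ltry.
apply: lte_mul_pinfty => //; apply: le_lt_trans Pi.
have -> : (\int[mu]_(t in `[2^-1%R, +oo[) (Phi t)%:E =
    \int[mu]_(t in `[2^-1%R, +oo[) (Phi `|t|)%:E)%E.
  apply: eq_integral => x; rewrite inE/= in_itv/= andbT => x0.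
  by rewrite ger0_norm//; lra.
apply: ge0_subset_integral => //.
  by apply/measurable_EFinP; exact: measurable_majorant.
by move=> x _; rewrite lee_fin majorant_ge0.
Qed.

Lemma cintegrable_majorant : ccontinuous f -> cintegrable f.
Proof.
move=> [cre cim]; have [_ _ fP _] := f_S.
have h (g : R -> R) : continuous g -> (forall x, `|g x| <= cmod (f x)) ->
    mu.-integrable setT (EFin \o g).
  move=> cg gf; have mg := continuous_measurable_fun cg.
  apply/integrableP; split; first exact/measurable_EFinP.
  have /integrableP[mP] := integrable_majorant; apply: le_lt_trans.
  apply: ae_ge0_le_integral => //.
  - by apply: measurableT_comp => //; exact/measurable_EFinP.
  - exact: measurableT_comp.
  - apply: (@filterS _ _ (ae_filter_ringOfSetsType mu) _ _ _ fP) => x fx _ /=.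
    by rewrite lee_fin (le_trans (gf x))// (le_trans fx)// ler_norm.
have sq (z : R[i]) (p : R) : p ^+ 2 <= cmod z ^+ 2 -> `|p| <= cmod z.
  move=> pz; have z0 : 0 <= cmod z by case: (z) => a b; exact: sqrtr_ge0.
  by rewrite -(ger0_norm z0) -ler_sqr ?nnegrE// !real_normK ?num_real.
split; apply: h => // x; apply: sq; rewrite sqr_cmod.
  by rewrite lerDl sqr_ge0.
by rewrite lerDr sqr_ge0.
Qed.

End radial_majorant.

(** * Integrability of the spectral density *)

Section covariance_transform.
Context {R : realType}.
Local Notation mu := (@lebesgue_measure R).
Variables (rho : R -> R) (alpha : R).
Hypothesis rho_fourier : fourier_exists (fun t => (rho t)%:C).
Hypothesis alpha_gt0 : 0 < alpha.
Hypothesis rho_alpha : (\int[mu]_z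
     (cmod (fourier (fun t => (rho t)%:C) z) * `|z| `^ alpha)%:E < +oo)%E.
Local Notation r := (cos_transform rho).

Lemma covariance_integrable : mu.-integrable setT (EFin \o rho).
Proof. by case: rho_fourier. Qed.

Lemma norm_cos_transform_fourier (z : R) :
  `|r z| <= cmod (fourier (fun t => (rho t)%:C) z).
Proof.
have -> : r z = complex.Re (fourier (fun t => (rho t)%:C) z).
  rewrite fourierE//=.
  have -> : \int[mu]_x (0 * sin (z * x)) = 0.
    by under eq_Rintegral do rewrite mul0r; rewrite Rintegral_cst// mul0r.
  by rewrite addr0.
have z0 (w : R[i]) : 0 <= cmod w by case: (w) => a b; exact: sqrtr_ge0.
rewrite -(ger0_norm (z0 _)) -ler_sqr ?nnegrE// !real_normK ?num_real//.
by rewrite sqr_cmod lerDl sqr_ge0.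
Qed.

Lemma integrable_powR_cos_transform :
  mu.-integrable setT (EFin \o (fun z => `|r z| * `|z| `^ alpha)).
Proof.
have mr : measurable_fun setT r.
  exact: continuous_measurable_fun (continuous_cos_transform covariance_integrable).
have mp : measurable_fun setT (fun z : R => `|z| `^ alpha).
  exact: (measurableT_comp (measurable_powR alpha) (@normr_measurable R setT)).
have mc : measurable_fun setT (fun z => cmod (fourier (fun t => (rho t)%:C) z)).
  have [cre cim] := ccontinuous_fourier rho_fourier.
  have -> : (fun z => cmod (fourier (fun t => (rho t)%:C) z)) =
      (fun z => Num.sqrt (cmod (fourier (fun t => (rho t)%:C) z) ^+ 2)).
    apply/funext => z; rewrite sqrtr_sqr ger0_norm//.
    by case: (fourier _ _) => a b; exact: sqrtr_ge0.
  apply: (measurableT_comp (continuous_measurable_fun (@sqrt_continuous R))).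
  by apply: measurable_sqr_cmod; split; exact: continuous_measurable_fun.
apply: integrable_finite_integral => //.
  by apply: measurable_funM => //; exact: measurableT_comp.
apply: le_lt_trans rho_alpha; apply: ge0_le_integral => //.
- apply/measurable_EFinP; apply: measurableT_comp => //.
  by apply: measurable_funM => //; exact: measurableT_comp.
- by apply/measurable_EFinP; apply: measurable_funM.
- move=> z _; rewrite lee_fin normrM normr_id [X in _ * X]ger0_norm ?powR_ge0//.
  by rewrite ler_wpM2r ?powR_ge0//; exact: norm_cos_transform_fourier.
Qed.

(** On [[-1, 1]] the L1 norm of [rho] bounds the transform; outside, the weight [|z|^alpha] is at
    least 1. *)
Lemma integrable_cos_transform : mu.-integrable setT (EFin \o r).
Proof.
have mr : measurable_fun setT r.
  exact: continuous_measurable_fun (continuous_cos_transform covariance_integrable).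
pose K := \int[mu]_x `|rho x|.
apply: (@integrable_of_le _ _ _ mu _ measurableT _
  (fun z => K * \1_(`[-1, 1]%classic : set R) z + `|r z| * `|z| `^ alpha)) => //.
- apply: integrable_add => //; last exact: integrable_powR_cos_transform.
  by apply: integrable_scale => //; exact: integrable_indic_itv.
- move=> z _; rewrite indicE; have [|] := boolP (z \in _).
    move=> _; rewrite mulr1.
    apply: (le_trans (norm_cos_transform_le covariance_integrable z)).
    by rewrite lerDl mulr_ge0// powR_ge0.
  rewrite notin_setE/= in_itv/= -ler_norml => /negP; rewrite -ltNge => z1.
  rewrite mulr0 add0r ler_peMr// -(powRr0 `|z|).
  by rewrite ler_powR// ltW.
Qed.

End covariance_transform.

Section geometric_series.
Context {R : realType}.

Lemma nneseries_geometric_lty (K q : R) : 0 <= K -> 0 <= q -> q < 1 ->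
  (\sum_(0 <= j <oo) (K * q ^+ j)%:E < +oo)%E.
Proof.
move=> K0 q0 q1.
apply: (@le_lt_trans _ _ (K / (1 - q))%:E); last exact: ltry.
have u0 j : (0 <= (K * q ^+ j)%:E)%E by rewrite lee_fin mulr_ge0// exprn_ge0.
apply: lime_le; first exact: is_cvg_nneseries.
apply: nearW => n; rewrite sumEFin lee_fin.
have -> : \sum_(0 <= j < n) K * q ^+ j = series (geometric K q) n by [].
rewrite geometric_seriesE ?lt_eqF//=.
rewrite ler_pM2r ?invr_gt0 ?subr_gt0// ler_piMr// lerBlDr lerDl.
exact: exprn_ge0.
Qed.

Lemma poweR_half_le (m : \bar R) (b : R) : (0 <= m)%E -> (m <= b%:E)%E ->
  (m `^ 2^-1 <= (b `^ 2^-1)%:E)%E.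
Proof.
move=> m0 mb; have mfin : m \is a fin_num by rewrite ge0_fin_numE// (le_lt_trans mb)// ltry.
move: m mfin m0 mb => [x| |]// _; rewrite poweR_EFin !lee_fin => x0 xb.
by rewrite ge0_ler_powR ?nnegrE// (le_trans x0).
Qed.

End geometric_series.

(** * Bounds on the coefficients, uniform in the translation *)

Section coefficient_bounds.
Context {R : realType} {d : measure_display} {Omega : measurableType d}.
Variable P : probability Omega R.
Local Notation mu := (@lebesgue_measure R).
Variables (X : R -> {RV P >-> R}) (rho : R -> R).
Hypothesis X_stationary : stationary_with_covariance X rho.
Hypothesis X_second : forall t, ('E_P[fun w => (`|X t w| ^+ 2)%R] < +oo)%E.
Hypothesis rho_cont : continuous rho.
Hypothesis rho_int : mu.-integrable setT (EFin \o rho).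
Local Notation r := (cos_transform rho).
Hypothesis r_int : mu.-integrable setT (EFin \o r).

Lemma coefficient_le (f : R -> R[i]) (H : R -> R) (Z : Omega -> R[i]) :
  ccontinuous f -> cintegrable f ->
  (forall z, cmod (fourier f z) ^+ 2 <= H z) -> (forall z, H (- z) = H z) ->
  mu.-integrable `[0, +oo[ (EFin \o (fun z => `|r z| * H z)) ->
  is_coefficient X f Z ->
  (mean_square P Z <=
    (4 * (fejer_mass^-1 * \int[mu]_(z in `[0, +oo[) (`|r z| * H z)))%:E)%E.
Proof.
move=> cf fi fH Heven Hi Zf; have [rei imi] := fi.
apply: (le_trans (coefficient_le_energy X_stationary X_second rho_cont rho_int
  r_int cf rei imi Zf)).
by rewrite lee_fin ler_wpM2l//; exact: spectral_energy_le.
Qed.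

Lemma rms_sup_le (I : Type) (Z : I -> Omega -> R[i]) (b : R) :
  (forall k, (mean_square P (Z k) <= b%:E)%E) ->
  (ereal_sup (range (fun k => rms P (Z k))) <= (b `^ 2^-1)%:E)%E.
Proof.
move=> Zb; apply: ub_ereal_sup => _ [k _ <-].
by apply: poweR_half_le => //; exact: mean_square_ge0.
Qed.

Lemma father_coefficient_le (phi : R -> R[i]) (xi : int -> Omega -> R[i]) :
  ccontinuous phi -> cintegrable phi ->
  (forall k, is_coefficient X (dilate_translate phi 0 k) (xi k)) ->
  exists b : R, (ereal_sup (range (fun k => rms P (xi k))) <= b%:E)%E.
Proof.
move=> cphi phii xi_def.
pose K := 2 * ((\int[mu]_x `|complex.Re (phi x)|) + (\int[mu]_x `|complex.Im (phi x)|)) ^+ 2.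
exists ((4 * (fejer_mass^-1 * \int[mu]_(z in `[0, +oo[) (`|r z| * K))) `^ 2^-1).
apply: rms_sup_le => k.
apply: (coefficient_le (f := dilate_translate phi 0 k) (H := fun=> K)) => //.
- exact: ccontinuous_dilate.
- exact: cintegrable_dilate.
- move=> z; rewrite cmod_fourier_dilate// expr0 invr1 mul1r.
  exact: cmod_fourier_le.
- have r0 : mu.-integrable `[0, +oo[ (EFin \o r).
    by apply: (@integrableS _ _ _ mu setT).
  apply: (@integrable_mulr_bounded _ _ _ mu _ _ (fun z => `|r z|) (fun=> K) `|K|) => //.
  exact: integrable_norm r0.
Qed.

Variables (psi : R -> R[i]) (alpha : R).
Hypothesis alpha_gt0 : 0 < alpha.
Hypothesis psi_cont : ccontinuous psi.
Hypothesis psi_int : cintegrable psi.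
Hypothesis psi0 : fourier psi 0 = 0.
Hypothesis psi_lipschitz : lipschitz_of_order (alpha / 2) (fourier psi).
Hypothesis r_alpha :
  mu.-integrable setT (EFin \o (fun z => `|r z| * `|z| `^ alpha)).

Lemma mother_coefficient_le (eta : nat -> int -> Omega -> R[i]) :
  (forall j k, is_coefficient X (dilate_translate psi j k) (eta j k)) ->
  exists2 C : R, 0 <= C & forall j,
    (ereal_sup (range (fun k => rms P (eta j k))) * (2 `^ (j%:R / 2))%:E <=
      (C * (2 `^ (- (alpha / 2))) ^+ j)%:E)%E.
Proof.
move=> eta_def; have [L psiL] := psi_lipschitz.
pose I := \int[mu]_(z in `[0, +oo[) (`|r z| * `|z| `^ alpha).
have I0 : 0 <= I by apply: Rintegral_ge0 => z _; rewrite mulr_ge0// powR_ge0.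
(* 4 comes from [coefficient_le_energy], [fejer_mass^-1] from inversion, [L ^+ 2] from the Lipschitz
   condition. *)
pose C := 4 * (fejer_mass^-1 * (L ^+ 2 * I)).
have M0 : 0 <= fejer_mass^-1 :> R by rewrite invr_ge0 ltW// fejer_mass_gt0.
have C0 : 0 <= C by rewrite mulr_ge0// mulr_ge0// mulr_ge0// sqr_ge0.
exists (C `^ 2^-1); first exact: powR_ge0.
move=> j; pose s : R := 2 ^- j.
have s0 : 0 <= s by rewrite invr_ge0 exprn_ge0.
have psiz z : cmod (fourier psi z) ^+ 2 <= L ^+ 2 * `|z| `^ alpha.
  have := psiL z 0; rewrite psi0 !subr0 => h.
  have z0 : 0 <= cmod (fourier psi z) by case: (fourier _ _) => a b; exact: sqrtr_ge0.
  have -> : L ^+ 2 * `|z| `^ alpha = (L * `|z| `^ (alpha / 2)) ^+ 2.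
    by rewrite exprMn -[X in _ = _ * X]powR_mulrn ?powR_ge0// -powRrM divfK.
  (* The sign of [L] is unknown, but the right-hand side is nonnegative because it bounds a
     modulus. *)
  by rewrite lerXn2r ?nnegrE// (le_trans z0).
(* The squared transform at scale [j] is at most [s * L^2 * |s z|^alpha = D * |z|^alpha]. *)
pose D := s * (L ^+ 2 * s `^ alpha).
have sup_le : (ereal_sup (range (fun k => rms P (eta j k))) <=
    ((C * (s * s `^ alpha)) `^ 2^-1)%:E)%E.
  apply: rms_sup_le => k.
  have -> : C * (s * s `^ alpha) = 4 * (fejer_mass^-1 *
      \int[mu]_(z in `[0, +oo[) (`|r z| * (D * `|z| `^ alpha))).
    under eq_Rintegral do rewrite mulrCA.
    rewrite RintegralZl//; last by apply: (@integrableS _ _ _ mu setT).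
    by rewrite /C /D -/I; ring.
  apply: (coefficient_le (f := dilate_translate psi j k)
    (H := fun z => D * `|z| `^ alpha)) => //.
  - exact: ccontinuous_dilate.
  - exact: cintegrable_dilate.
  - move=> z; rewrite cmod_fourier_dilate// /D -mulrA ler_wpM2l//.
    apply: (le_trans (psiz _)).
    by rewrite normrM powRM// (ger0_norm s0) [in leLHS](mulrC (`|z| `^ _)) mulrA.
  - by move=> z; rewrite normrN.
  - have -> : (fun z => `|r z| * (D * `|z| `^ alpha)) =
        (fun z => D * (`|r z| * `|z| `^ alpha)).
      by apply/funext => z; rewrite mulrCA.
    apply: integrable_scale => //.
    by apply: (@integrableS _ _ _ mu setT).
apply: (le_trans (lee_wpmul2r _ sup_le)); first by rewrite lee_fin powR_ge0.
rewrite -EFinM lee_fin powRM//; last by rewrite mulr_ge0// powR_ge0.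
rewrite -mulrA ler_wpM2l ?powR_ge0//.
have sE : s = 2 `^ (- j%:R) by rewrite powR_invn.
have n2 : (2 : R) != 0 by [].
have -> : s * s `^ alpha = 2 `^ (- j%:R + - j%:R * alpha).
  by rewrite powRD ?n2 ?implybT// powRrM -sE.
rewrite -powRrM -powRD ?n2 ?implybT// -powR_mulrn ?powR_ge0// -powRrM.
(* The weight [2^(j/2)] cancels the half power of the dilation factor [s]; the exponent left is
   linear in [j]. *)
have -> : (- j%:R + - j%:R * alpha) / 2 + j%:R / 2 = - (alpha / 2) * j%:R by field.
exact: lexx.
Qed.

End coefficient_bounds.

Theorem theorem6 (R : realType) (d : measure_display)
  (Omega : measurableType d) (P : probability Omega R)
  (vphi : R -> R) (X : R -> {RV P >-> R}) (rho : R -> R)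
  (phi psi : R -> R[i]) (Phi c : R -> R) (T p alpha : R)
  (xi : int -> Omega -> R[i]) (eta : nat -> int -> Omega -> R[i])
  (vphi_orlicz : orlicz_N_function vphi)
  (vphi_Q : assumption_Q vphi)
  (X_strict : strictly_Sub vphi X)
  (X_stationary : stationary_with_covariance X rho)
  (X_short : short_memory rho)
  (X_mean : forall t, ('E_P[X t] = 0)%E)
  (X_second : forall t, ('E_P[fun w => (`|X t w| ^+ 2)%R] < +oo)%E)
  (rho_cont : continuous rho)
  (phi_wavelet : f_wavelet phi)
  (psi_wavelet : m_wavelet phi psi)
  (phi_cont : ccontinuous phi)
  (psi_cont : ccontinuous psi)
  (phi_S : assumption_S Phi phi)
  (psi_S : assumption_S Phi psi)
  (c_even : forall x, c (- x) = c x)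
  (c_nondecreasing : {in `[0, +oo[ &, {homo c : x y / x <= y}})
  (c_0 : 1 < c 0)
  (c_growth : exists (A : R -> R) (x0 : R),
     (forall a : R, 0 < a -> 0 < A a) /\
     (forall x a : R, x0 <= x -> 0 < a -> c (a * x) <= c x * A a))
  (c_Phi : (\int[lebesgue_measure]_x (c x * Phi `|x|)%:E < +oo)%E)
  (rho_c : forall t, `|rho 0| `^ 2^-1 <= c t)
  (T_gt0 : 0 < T)
  (p_ge1 : 1 <= p)
  (X_p : (\int[lebesgue_measure]_(t in `[0%R, T])
            ('E_P[fun w => (X t w ^+ 2)%R] `^ (p / 2)) < +oo)%E)
  (rho_fourier : fourier_exists (fun t => (rho t)%:C))
  (alpha_gt0 : 0 < alpha)
  (rho_alpha : (\int[lebesgue_measure]_z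
     (cmod (fourier (fun t => (rho t)%:C) z) * `|z| `^ alpha)%:E < +oo)%E)
  (psi_lipschitz : lipschitz_of_order (alpha / 2) (fourier psi))
  (xi_def : forall k, is_coefficient X (dilate_translate phi 0 k) (xi k))
  (eta_def : forall j k, is_coefficient X (dilate_translate psi j k) (eta j k)) :
  (ereal_sup (range (fun k => rms P (xi k))) * C_S Phi +
   \sum_(0 <= j <oo)
     (ereal_sup (range (fun k => rms P (eta j k))) *
        (2 `^ (j%:R / 2))%:E * C_S Phi) < +oo)%E.
Proof.
have rho_int := covariance_integrable rho_fourier.
have r_int := integrable_cos_transform rho_fourier alpha_gt0 rho_alpha.
have r_alpha := integrable_powR_cos_transform rho_fourier rho_alpha.
have phi_int := cintegrable_majorant phi_S phi_cont.
have psi_int := cintegrable_majorant psi_S psi_cont.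
have psi0 := m_wavelet_fourier0 phi_wavelet psi_wavelet psi_int.
have CS0 := C_S_ge0 phi_S; have CSy := C_S_lty phi_S.
have CSfin : C_S Phi \is a fin_num by rewrite ge0_fin_numE.
(* The index [i] matters: over an empty type the supremum would be [-oo]. *)
have rms0 (I : Type) (i : I) (Z : I -> Omega -> R[i]) :
    (0 <= ereal_sup (range (fun k => rms P (Z k))))%E.
  by apply: (le_trans (poweR_ge0 (mean_square P (Z i)) 2^-1)); apply: ereal_sup_ubound; exists i.
rewrite lte_add_pinfty//.
  have [b xib] := father_coefficient_le X_stationary X_second rho_cont rho_int
    r_int phi_cont phi_int xi_def.
  apply: (@le_lt_trans _ _ (b%:E * C_S Phi)%E); first exact: lee_wpmul2r.
  by rewrite -(fineK CSfin) -EFinM ltry.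
have [C C0 Ceta] := mother_coefficient_le X_stationary X_second rho_cont rho_int
  r_int psi_cont psi_int psi0 psi_lipschitz r_alpha eta_def.
pose q : R := 2 `^ (- (alpha / 2)).
have q1 : q < 1.
  rewrite /q powRN invf_lt1 ?powR_gt0// /powR pnatr_eq0/= expR_gt1.
  by rewrite mulr_gt0 ?divr_gt0// ln_gt0// ltr1n.
apply: (@le_lt_trans _ _ (\sum_(0 <= j <oo) (C * fine (C_S Phi) * q ^+ j)%:E)%E).
  apply: lee_nneseries => [j _ _|j _].
    apply: mule_ge0 => //; apply: mule_ge0; first exact: (rms0 _ (0 : int)).
    by rewrite lee_fin powR_ge0.
  apply: (le_trans (lee_wpmul2r CS0 (Ceta j))).
  by rewrite -[in leLHS](fineK CSfin) -EFinM mulrAC.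
apply: nneseries_geometric_lty => //; last exact: powR_ge0.
by rewrite mulr_ge0// fine_ge0.
Qed.
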